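(* Let $\Omega$ be a star graph with $n$ edges $\epsilon_i\cong[0,\ell_i]$, let $V_i\in L^1(0,\ell_i)$ for $1\le i\le n$, and let $\Gamma=\{\alpha_1,\alpha_2,\beta_1,\beta_2\}$ be separated self-adjoint boundary conditions with $\beta_1,\beta_2$ diagonal. Suppose $\Omega$ is split into three subgraphs $\Omega_1,\tilde\Omega_1,\tilde\Omega_2$ by first splitting $\Omega$ at a non-vertex point $x_j=s_1$ into $\Omega_1$ and $\Omega_2$, and then splitting $\Omega_2$ at a non-vertex point $x_i=s_2$ into $\tilde\Omega_1$ and $\tilde\Omega_2$ (either on the same wire, $i=j$ and $0<s_2<s_1<\ell_j$, or on different wires, $i\neq j$), with boundary conditions $\Gamma_1,\tilde\Gamma_1,\tilde\Gamma_2$ that agree with $\Gamma$ at the original vertices and are Dirichlet at the splitting points. Suppose $\lambda\in\rho(H^{\Omega_1}_{\Gamma_1})\cap\rho(H^{\tilde\Omega_1}_{\tilde\Gamma_1})\cap\rho(H^{\tilde\Omega_2}_{\tilde\Gamma_2})$ and let $\mathcal M_1+\mathcal M_2$ be the two-sided map associated with $s_1$ and $s_2$. Then $$\frac{E^{\Omega}_{\Gamma}(\lambda)}{E^{\Omega_1}_{\Gamma_1}(\lambda)\,E^{\tilde\Omega_1}_{\tilde\Gamma_1}(\lambda)\,E^{\tilde\Omega_2}_{\tilde\Gamma_2}(\lambda)}=\det\big((\mathcal M_1+\mathcal M_2)(\lambda)\big),$$ where $E^{\Omega}_{\Gamma},E^{\Omega_1}_{\Gamma_1},E^{\tilde\Omega_1}_{\tilde\Gamma_1},E^{\tilde\Omega_2}_{\tilde\Gamma_2}$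 are the Evans functions associated with $H^{\Omega}_{\Gamma},H^{\Omega_1}_{\Gamma_1},H^{\tilde\Omega_1}_{\tilde\Gamma_1},H^{\tilde\Omega_2}_{\tilde\Gamma_2}$ respectively.
   Context: **Star graph and functions.** $\Omega$ has $n\ge1$ edges; edge $\epsilon_i$ has coordinate $x_i\in[0,\ell_i]$, $\ell_i>0$, where $x_i=0$ is the common vertex (origin) of all edges. A function on $\Omega$ is a vector $\vec u=(u_1,\dots,u_n)$ with $u_i$ a function of $x_i$; $\vec u'=(u_1',\dots,u_n')$; $\vec u(\vec 0)=(u_i(0))_i$ and $\vec u(\vec\ell)=(u_i(\ell_i))_i$. **Boundary conditions.** $\Gamma=\{\alpha_1,\alpha_2,\beta_1,\beta_2\}$ consists of complex $n\times n$ matrices with $\operatorname{rank}[\alpha_1\ \alpha_2]=\operatorname{rank}[\beta_1\ \beta_2]=n$, $\alpha_1\alpha_2^*=\alpha_2\alpha_1^*$, $\beta_1\beta_2^*=\beta_2\beta_1^*$, and $\beta_1=\operatorname{diag}(g_1,\dots,g_n)$, $\beta_2=\operatorname{diag}(h_1,\dots,h_n)$. A function $\vec u$ satisfies $\Gamma$ if $\alpha_1\vec u(\vec 0)+\alpha_2\vec u'(\vec 0)=\vec 0$ and $\beta_1\vec u(\vec\ell)+\beta_2\vec u'(\vec\ell)=\vec 0$. **Operators.** $H^\Omega=\operatorname{diag}(-\partial_{x_i}^2+V_i(x_i))$ is a differential expression; $H^{\Omega^*}$ is its restriction to a subgraph $\Omega^*$. Solutions of $(H^{\Omega^*}-\lambda)\vec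 u=\vec 0$ are understood with $u_i,u_i'$ absolutely continuous on the closed edge and the equation holding a.e. For boundary conditions $\Gamma_0$ on $\Omega^*$, $H^{\Omega^*}_{\Gamma_0}$ is the operator $\vec u\mapsto H^{\Omega^*}\vec u$ in $L^2(\Omega^* )$ with domain the functions satisfying $\Gamma_0$ such that $u_i,u_i'$ are absolutely continuous and $-u_i''+V_iu_i\in L^2$ (this is $u_i\in H^2$ when $V_i\in L^2$). $\rho(\cdot)$ denotes the resolvent set. **The splitting.** $\Omega_1=[s_1,\ell_j]\subset\epsilon_j$, $0<s_1<\ell_j$, and $\Omega_2$ is the star graph with $\epsilon_j$ shortened to $[0,s_1]$. Next, $\Omega_2$ is split at a non-vertex point $x_i=s_2$, with the origin in $\tilde\Omega_2$: - Same wire ($i=j$, $0<s_2<s_1$): $\tilde\Omega_1=[s_2,s_1]\subset\epsilon_j$, and $\tilde\Omega_2$ is the star graph with $\epsilon_j$ shortened to $[0,s_2]$. - Different wires ($i\ne j$, $0<s_2<\ell_i$): $\tilde\Omega_1=[s_2,\ell_i]\subset\epsilon_i$, and $\tilde\Omega_2$ is the star graph with $\epsilon_j$ shortened to $[0,s_1]$ and $\epsilon_i$ shortened to $[0,s_2]$. **Boundary conditions on the pieces.** Dirichlet conditions at a splitting point are always represented by coefficient $1$ of $u$ and $0$ of $u'$. On an interval piece, the left endpoint plays the role of the origin ($1\times1$ matrices $\alpha_1,\alpha_2$) and the right endpoint the role of the outer vertex ($1\times 1$ matrices $\beta_1,\beta_2$). $\Gamma_1$ on $\Omega_1$: $u(s_1)=0$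 and $g_ju(\ell_j)+h_ju'(\ell_j)=0$ ($\beta_1=g_j$, $\beta_2=h_j$). $\tilde\Gamma_1$ on $\tilde\Omega_1$: same wire: $u(s_2)=0$, $u(s_1)=0$; different wires: $u(s_2)=0$, $g_iu(\ell_i)+h_iu'(\ell_i)=0$ ($\beta_1=g_i$, $\beta_2=h_i$). $\tilde\Gamma_2$ on $\tilde\Omega_2$: the matrices are those of $\Gamma$, except that on each shortened edge $k$ the diagonal entries $g_k,h_k$ are replaced by $1,0$ and $\ell_k$ by the splitting point (Dirichlet condition at $s_2$; in the different-wire case also at $s_1$). **Evans function.** For a star graph (or interval) with matrices $\alpha_1,\alpha_2,\beta_1,\beta_2$ and outer endpoints $\vec\ell$, let $Y(\vec x,\lambda),Z(\vec x,\lambda)$ be the square matrices whose columns are solutions of $(H-\lambda)\vec u=\vec 0$ (the $k$-th row being a function of $x_k$) with $$Y(\vec 0)=-\alpha_2^*,\quad Y'(\vec 0)=\alpha_1^*,\qquad Z(\vec\ell)=-\beta_2^*,\quad Z'(\vec\ell)=\beta_1^* .$$ The Evans function is $E(\lambda)=\det\begin{bmatrix} Y(\vec x,\lambda) & Z(\vec x,\lambda) \\ Y'(\vec x,\lambda) & Z'(\vec x,\lambda) \end{bmatrix}$, which does not depend on $\vec x$. For interval pieces $\vec 0$ is replaced by the left endpoint; for shortened edges $\ell_k$ is replaced by the splitting point. **Two-sided map, same wire.** For $\vec f=(f_1,f_2)\in\mathbb C^2$: $\mathcal M_1(\lambda)\vec f=(u'(s_1),-u'(s_2))^t$, where $u$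 solves $(H^{\tilde\Omega_1}-\lambda)u=0$ on $[s_2,s_1]$ with $u(s_1)=f_1$, $u(s_2)=f_2$. $\mathcal M_2(\lambda)\vec f=(-u'(s_1),w_j'(s_2))^t$, where $u$ solves $(H^{\Omega_1}-\lambda)u=0$ with $u(s_1)=f_1$ and the $\Gamma_1$ condition at $\ell_j$, and $\vec w$ solves $(H^{\tilde\Omega_2}-\lambda)\vec w=\vec 0$ with $w_j(s_2)=f_2$ and all other $\tilde\Gamma_2$ conditions. **Two-sided map, different wires.** $\mathcal M_1(\lambda)\vec f=(-u'(s_1),-w'(s_2))^t$, where $u$ solves $(H^{\Omega_1}-\lambda)u=0$ with $u(s_1)=f_1$ and the $\Gamma_1$ condition at $\ell_j$, and $w$ solves $(H^{\tilde\Omega_1}-\lambda)w=0$ with $w(s_2)=f_2$ and the $\tilde\Gamma_1$ condition at $\ell_i$. $\mathcal M_2(\lambda)\vec f=(u_j'(s_1),u_i'(s_2))^t$, where $\vec u$ solves $(H^{\tilde\Omega_2}-\lambda)\vec u=\vec 0$ with $u_j(s_1)=f_1$, $u_i(s_2)=f_2$ and all other $\tilde\Gamma_2$ conditions. In both cases these problems have unique solutions for the given $\lambda$, $\mathcal M_1,\mathcal M_2$ are $2\times2$ matrices, and the two-sided map is $\mathcal M_1+\mathcal M_2$. *)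

(* Defs.v *)
From HB Require Import structures.
From mathcomp Require Import all_boot all_order all_algebra spectral.
From mathcomp Require Import complex.
From mathcomp Require Import all_classical all_reals all_analysis.

Set Implicit Arguments.
Unset Strict Implicit.
Unset Printing Implicit Defensive.

Import Order.TTheory GRing.Theory Num.Theory.
Import numFieldNormedType.Exports.

Local Open Scope classical_set_scope.
Local Open Scope ring_scope.
Local Open Scope sesquilinear_scope.

(* Complex-valued functions of a real variable are handled through their real
   and imaginary parts. *)
Definition both_parts (R : realType) (P : (R -> R) -> Prop) (f : R -> R[i]) :=
  P (fun x => complex.Re (f x)) /\ P (fun x => complex.Im (f x)).

(* Derivative relative to the closed interval [a, b]: it is one-sided at the
   endpoints. *)
Definition real_deriv_in (R : realType) (a b : R) (f : R -> R) (x d : R) : Prop :=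
  (fun y => (f y - f x) / (y - x)) @ within [set` `[a, b]] (x^') --> d.

Definition deriv_in (R : realType) (a b : R) (f : R -> R[i]) (x : R)
    (d : R[i]) : Prop :=
  real_deriv_in a b (fun y => complex.Re (f y)) x (complex.Re d) /\
  real_deriv_in a b (fun y => complex.Im (f y)) x (complex.Im d).

Definition real_abs_cont (R : realType) (a b : R) (f : R -> R) : Prop :=
  forall e : R, 0 < e -> exists2 d : R, 0 < d &
    forall (N : nat) (s t : 'I_N -> R),
      (forall k, a <= s k <= t k /\ t k <= b) ->
      (forall k l, k != l -> t k <= s l \/ t l <= s k) ->
      \sum_(k < N) (t k - s k) < d ->
      \sum_(k < N) `|f (t k) - f (s k)| < e.

Definition abs_cont (R : realType) (a b : R) : (R -> R[i]) -> Prop :=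
  both_parts (real_abs_cont a b).

Definition L1_on (R : realType) (a b : R) : (R -> R[i]) -> Prop :=
  both_parts (fun f =>
    (@lebesgue_measure R).-integrable [set` `[a, b]] (EFin \o f)).

Definition L2_sqnorm (R : realType) (a b : R) (f : R -> R[i]) : \bar R :=
  (\int[@lebesgue_measure R]_(x in [set` `[a, b]])
     (complex.Re (f x) ^+ 2 + complex.Im (f x) ^+ 2)%:E)%E.

Definition L2_on (R : realType) (a b : R) (f : R -> R[i]) : Prop :=
  both_parts (fun h => measurable_fun [set` `[a, b]] h) f /\
  (L2_sqnorm a b f < +oo)%E.

(* Edge [k] is the interval [org k, out k] with potential [pot k]; the common
   vertex is the left endpoint of every edge.  An interval is the case n = 1. *)
Record star_graph (R : realType) (n : nat) := StarGraph {
  org : 'I_n -> R;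
  out : 'I_n -> R;
  pot : 'I_n -> R -> R[i] }.

Record bound_cond (R : realType) (n : nat) := BoundCond {
  alpha1 : 'M[R[i]]_n;
  alpha2 : 'M[R[i]]_n;
  beta1 : 'M[R[i]]_n;
  beta2 : 'M[R[i]]_n }.

Definition interval_graph (R : realType) (a b : R) (v : R -> R[i]) :
    star_graph R 1 :=
  StarGraph (fun _ => a) (fun _ => b) (fun _ => v).

Definition interval_cond (R : realType) (a1 a2 b1 b2 : R[i]) :
    bound_cond R 1 :=
  BoundCond a1%:M a2%:M b1%:M b2%:M.

Definition selfadjoint_cond (R : realType) (n : nat) (G : bound_cond R n) :
    Prop :=
  [/\ \rank (row_mx (alpha1 G) (alpha2 G)) = n,
      \rank (row_mx (beta1 G) (beta2 G)) = n,
      alpha1 G *m (alpha2 G)^t* = alpha2 G *m (alpha1 G)^t* &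
      beta1 G *m (beta2 G)^t* = beta2 G *m (beta1 G)^t*].

Section Operators.
Context (R : realType) (n : nat).
Implicit Types (Om : star_graph R n) (G : bound_cond R n) (lam : R[i]).
Implicit Types u p f : 'I_n -> R -> R[i].

Definition on_edge Om (k : 'I_n) (x : R) : Prop := org Om k <= x <= out Om k.

(* u and p = u' are absolutely continuous on the closed edges and
   - u'' + V u = f almost everywhere. *)
Definition schrodinger Om u p f : Prop :=
  forall k,
  [/\ abs_cont (org Om k) (out Om k) (u k),
      forall x, on_edge Om k x -> deriv_in (org Om k) (out Om k) (u k) x (p k x),
      abs_cont (org Om k) (out Om k) (p k) &
      {ae @lebesgue_measure R, forall x, on_edge Om k x ->
        exists2 d, deriv_in (org Om k) (out Om k) (p k) x d &
          - d + pot Om k x * u k x = f k x}].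

(* (H - lam) u = 0, with p = u'. *)
Definition solution Om lam u p : Prop :=
  schrodinger Om u p (fun k x => lam * u k x).

Definition origin_cond Om G u p : Prop :=
  alpha1 G *m (\col_k u k (org Om k)) + alpha2 G *m (\col_k p k (org Om k)) = 0.

Definition outer_cond Om G u p : Prop :=
  beta1 G *m (\col_k u k (out Om k)) + beta2 G *m (\col_k p k (out Om k)) = 0.

Definition L2 Om f : Prop := forall k, L2_on (org Om k) (out Om k) (f k).

Definition sqnorm Om f : \bar R :=
  (\sum_(k < n) L2_sqnorm (org Om k) (out Om k) (f k))%E.

(* u is in the domain of H_Gamma and H_Gamma u = f. *)
Definition operator_graph Om G u f : Prop :=
  L2 Om f /\
  exists p, [/\ schrodinger Om u p f, origin_cond Om G u p & outer_cond Om G u p].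

(* H_Gamma - lam is a bijection from its domain onto L2 with bounded inverse.
   Elements of L2 are represented by functions, the equation being almost
   everywhere; elements of the domain are continuous, so that they are equal as
   soon as they agree at every point of the edges. *)
Definition resolvent_set Om G : set R[i] := [set lam |
  [/\ forall f, L2 Om f ->
        exists u, operator_graph Om G u (fun k x => f k x + lam * u k x),
      forall f u v,
        operator_graph Om G u (fun k x => f k x + lam * u k x) ->
        operator_graph Om G v (fun k x => f k x + lam * v k x) ->
        forall k x, on_edge Om k x -> u k x = v k x &
      exists2 K : R, 0 <= K & forall f u,
        operator_graph Om G u (fun k x => f k x + lam * u k x) ->
        (sqnorm Om u <= K%:E * sqnorm Om f)%E]].

(* [Y k c] is the entry in row k, column c, a function on edge k. *)
Definition mx_at (Y : 'I_n -> 'I_n -> R -> R[i]) (x : 'I_n -> R) : 'M[R[i]]_n :=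
  \matrix_(k, c) Y k c (x k).

Definition is_evans Om G lam (E : R[i]) : Prop :=
  exists Y Y' Z Z' : 'I_n -> 'I_n -> R -> R[i],
  [/\ forall c, solution Om lam (Y^~ c) (Y'^~ c),
      forall c, solution Om lam (Z^~ c) (Z'^~ c),
      mx_at Y (org Om) = - (alpha2 G)^t* /\ mx_at Y' (org Om) = (alpha1 G)^t*,
      mx_at Z (out Om) = - (beta2 G)^t* /\ mx_at Z' (out Om) = (beta1 G)^t* &
      forall x, (forall k, on_edge Om k (x k)) ->
        E = \det (block_mx (mx_at Y x) (mx_at Z x) (mx_at Y' x) (mx_at Z' x))].

(* The fundamental matrices exist and are unique for integrable potentials; the
   default value 0 is never used in that case. *)
Definition evans Om G lam : R[i] := xget 0 [set E | is_evans Om G lam E].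

End Operators.

Section Splitting.
Context (R : realType) (n : nat).
Variables (ell : 'I_n -> R) (V : 'I_n -> R -> R[i]) (G : bound_cond R n).
Variables (i j : 'I_n) (s1 s2 : R).

Definition star : star_graph R n := StarGraph (fun _ => 0) ell V.

Definition piece1 : star_graph R 1 := interval_graph s1 (ell j) (V j).

(* beta1 and beta2 are meant to be diagonal: beta1 G j j is g_j and beta2 G j j
   is h_j. *)
Definition cond1 : bound_cond R 1 :=
  interval_cond 1 0 (beta1 G j j) (beta2 G j j).

Definition tpiece1 : star_graph R 1 :=
  interval_graph s2 (if i == j then s1 else ell i) (V i).

Definition tcond1 : bound_cond R 1 :=
  if i == j then interval_cond 1 0 1 0
  else interval_cond 1 0 (beta1 G i i) (beta2 G i i).

(* On the same wire (i = j) the only shortened edge is j, of length s2. *)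
Definition tpiece2 : star_graph R n :=
  StarGraph (fun _ => 0)
    (fun k => if k == i then s2 else if k == j then s1 else ell k) V.

Definition shortened (k : 'I_n) : bool := (k == i) || (k == j).

Definition tcond2 : bound_cond R n :=
  BoundCond (alpha1 G) (alpha2 G)
    (diag_mx (\row_k if shortened k then 1 else beta1 G k k))
    (diag_mx (\row_k if shortened k then 0 else beta2 G k k)).

Variable lam : R[i].

(* Value at the vector f of a two-sided map block: f and the value are column
   vectors indexed by (s1, s2). *)
Definition pair_col (x y : R[i]) : 'cV[R[i]]_2 :=
  \col_k if k == 0 then x else y.

(* [piece1_problem c d]: d = u'(s1), where u solves (H - lam) u = 0 on piece1
   with u(s1) = c and the Gamma_1 condition at the right endpoint. *)
Definition piece1_problem (c d : R[i]) : Prop :=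
  exists u p : 'I_1 -> R -> R[i],
  [/\ solution piece1 lam u p, u 0 s1 = c, outer_cond piece1 cond1 u p &
      d = p 0 s1].

Definition tpiece2_problem (w p : 'I_n -> R -> R[i]) : Prop :=
  [/\ solution tpiece2 lam w p, origin_cond tpiece2 tcond2 w p &
      forall k, ~~ shortened k ->
        beta1 tcond2 k k * w k (out tpiece2 k)
        + beta2 tcond2 k k * p k (out tpiece2 k) = 0].

Definition same_wire_map1 (f y : 'cV[R[i]]_2) : Prop :=
  exists u p : 'I_1 -> R -> R[i],
  [/\ solution tpiece1 lam u p, u 0 s1 = f 0 0, u 0 s2 = f 1 0 &
      y = pair_col (p 0 s1) (- p 0 s2)].

Definition same_wire_map2 (f y : 'cV[R[i]]_2) : Prop :=
  exists2 d, piece1_problem (f 0 0) d &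
  exists w p, [/\ tpiece2_problem w p, w j s2 = f 1 0 &
                  y = pair_col (- d) (p j s2)].

Definition diff_wire_map1 (f y : 'cV[R[i]]_2) : Prop :=
  exists2 d, piece1_problem (f 0 0) d &
  exists w p : 'I_1 -> R -> R[i],
  [/\ solution tpiece1 lam w p, w 0 s2 = f 1 0, outer_cond tpiece1 tcond1 w p &
      y = pair_col (- d) (- p 0 s2)].

Definition diff_wire_map2 (f y : 'cV[R[i]]_2) : Prop :=
  exists u p, [/\ tpiece2_problem u p, u j s1 = f 0 0, u i s2 = f 1 0 &
                  y = pair_col (p j s1) (p i s2)].

Definition map1 : 'cV[R[i]]_2 -> 'cV[R[i]]_2 -> Prop :=
  if i == j then same_wire_map1 else diff_wire_map1.

Definition map2 : 'cV[R[i]]_2 -> 'cV[R[i]]_2 -> Prop :=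
  if i == j then same_wire_map2 else diff_wire_map2.

(* The matrix of a map given by its graph. *)
Definition matrix_of (T : 'cV[R[i]]_2 -> 'cV[R[i]]_2 -> Prop) : 'M[R[i]]_2 :=
  xget 0 [set M | forall f, T f (M *m f)].

Definition M1 : 'M[R[i]]_2 := matrix_of map1.
Definition M2 : 'M[R[i]]_2 := matrix_of map2.

End Splitting.

(* Main.v *)
Require Import Defs.
From mathcomp Require Import all_boot all_order all_algebra complex.
From mathcomp Require Import all_classical all_reals all_analysis.
From mathcomp Require Import spectral measurable_realfun ring lra.
Import Order.TTheory GRing.Theory Num.Theory.
Import numFieldNormedType.Exports.
Local Open Scope classical_set_scope.
Local Open Scope ring_scope.

(* Let zeta_k be the solution on edge k that satisfies the (diagonal) outer
   condition.  In the determinant defining the Evans function the right blocks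
   are then diagonal, and E collapses to the n x n determinant B of the
   Wronskians of Y_kc and zeta_k, each of which is constant along edge k.
   Shortening edges replaces the corresponding rows of B by Y_k(s_k), which
   gives the matrix B~ of the third piece.  Evaluating the rows of B at the
   splitting points yields B = (D1 - D2 T) B~, where D1, D2 are diagonal with
   entries zeta_k'(s_k), zeta_k(s_k) on the shortened edges (and 1, 0 on the
   others) and T = Y'(s) B~^-1 is the Dirichlet-to-Neumann matrix of the third
   piece.  Hence E / E~2 is the principal minor of D1 - D2 T on the shortened
   edges, of size 2 or 1, which is compared with the two-sided map by hand; the
   other Evans functions are the values -zeta_k(s_k).  On the same wire, the
   Wronskians of zeta with two Dirichlet solutions of the middle interval give
   the relations needed.

   The ODE theory for integrable potentials rests on two facts: solutions exist
   (Picard iteration, the n-th difference being at most Q^n / n! with Q a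
   primitive of the coefficients), and an absolutely continuous function whose
   derivative vanishes almost everywhere is constant, so that Wronskians are
   constant and solutions are determined by their Cauchy data at any point. *)

Set Implicit Arguments.
Unset Strict Implicit.
Unset Printing Implicit Defensive.

(** * Real analysis *)

Section RealDerivative.
Context (R : realType).
Implicit Types (a b x d e : R) (f g : R -> R).

(** With the denominator cleared, the estimate also makes sense at y = x, so later arguments need
    not keep away from the base point. *)
Lemma real_deriv_inP a b f x d : real_deriv_in a b f x d <->
  forall e, 0 < e -> exists2 r, 0 < r & forall y, a <= y <= b -> `|y - x| < r ->
    `|f y - f x - d * (y - x)| <= e * `|y - x|.
Proof.
have quot y : y - x != 0 ->
    f y - f x - d * (y - x) = - (d - (f y - f x) / (y - x)) * (y - x).
  by move=> yx; field.
split => [/cvgrPdist_le fd e e0|fd].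
  have [r /= r0 fr] := fd e e0; exists r => // y yab yx.
  have [->|ynx] := eqVneq y x; first by rewrite !subrr mulr0 subr0 normr0 mulr0.
  have yx0 : y - x != 0 by rewrite subr_eq0.
  rewrite quot// normrM normrN ler_wpM2r//.
  by apply: fr => //=; rewrite distrC.
apply/cvgrPdist_le => e e0; have [r r0 fr] := fd e e0.
exists r => //= y /=; rewrite distrC => yx ynx yab.
have yx0 : y - x != 0 by rewrite subr_eq0.
have := fr y yab yx; rewrite quot// normrM normrN ler_pM2r//.
by rewrite normr_gt0.
Qed.

Lemma real_deriv_in_subset a b a' b' f x d : a <= a' -> b' <= b ->
  real_deriv_in a b f x d -> real_deriv_in a' b' f x d.
Proof.
move=> aa bb /real_deriv_inP fd; apply/real_deriv_inP => e /fd[r r0 fr].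
exists r => // y /andP[a'y yb']; apply: fr.
by rewrite (le_trans aa)//= (le_trans yb').
Qed.

Lemma real_deriv_in_cont a b f x d : real_deriv_in a b f x d ->
  f @ within [set` `[a, b]] (x^') --> f x.
Proof.
move=> fd; have xx : (fun y : R => y - x) @ within [set` `[a, b]] (x^') --> (0 : R).
  apply/cvgrPdist_lt => e e0; exists e => //= y /=.
  by rewrite sub0r normrN distrC.
rewrite -[X in _ --> X]addr0 -(mulr0 d).
have h : (fun y => f x + (f y - f x) / (y - x) * (y - x))
    @ within [set` `[a, b]] (x^') --> f x + d * 0.
  by apply: cvgD; [exact: cvg_cst|exact: cvgM].
apply: cvg_trans h; apply: near_eq_cvg.
exists 1 => //= y /= _ yx _.
by rewrite -mulrA mulVf ?mulr1 ?subr_eq0//= addrC subrK.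
Qed.

Lemma real_deriv_inM a b f g x c d :
  real_deriv_in a b f x c -> real_deriv_in a b g x d ->
  real_deriv_in a b (fun y => f y * g y) x (c * g x + f x * d).
Proof.
move=> fd gd.
have : (fun y => (f y - f x) / (y - x) * g x + f y * ((g y - g x) / (y - x)))
    @ within [set` `[a, b]] (x^') --> c * g x + f x * d.
  apply: cvgD; apply: cvgM => //; first exact: cvg_cst.
  exact: real_deriv_in_cont fd.
apply: cvg_trans; apply: near_eq_cvg.
exists 1 => //= y /= _ yx _ /=.
have yx0 : y - x != 0 by rewrite subr_eq0.
by field.
Qed.

Lemma real_deriv_inD a b f g x c d :
  real_deriv_in a b f x c -> real_deriv_in a b g x d ->
  real_deriv_in a b (fun y => f y + g y) x (c + d).
Proof.
move=> fd gd; rewrite /real_deriv_in.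
have -> : (fun y => (f y + g y - (f x + g x)) / (y - x)) =
    (fun y => (f y - f x) / (y - x) + (g y - g x) / (y - x)).
  by apply/funext => y; rewrite -mulrDl; congr (_ / _); ring.
exact: cvgD.
Qed.

Lemma real_deriv_inN a b f x c :
  real_deriv_in a b f x c -> real_deriv_in a b (fun y => - f y) x (- c).
Proof.
move=> fd; rewrite /real_deriv_in.
have -> : (fun y => (- f y - - f x) / (y - x)) =
    (fun y => - ((f y - f x) / (y - x))).
  by apply/funext => y; rewrite -mulNr; congr (_ / _); ring.
exact: cvgN.
Qed.

Lemma real_deriv_in_cst a b x c : real_deriv_in a b (fun=> c) x 0.
Proof.
apply/real_deriv_inP => e e0; exists 1 => // y _ _.
by rewrite subrr mul0r subrr normr0 mulr_ge0// ltW.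
Qed.


Lemma derivable_real_deriv_in a b f x : derivable f x 1 ->
  real_deriv_in a b f x (derive1 f x).
Proof.
rewrite /derivable derive1E /derive => /cvgrPdist_le fd.
apply/real_deriv_inP => e e0; have [r /= r0 fr] := fd e e0.
set d := lim _ in fr *; exists r => // y yab yx.
have [->|ynx] := eqVneq y x; first by rewrite !subrr mulr0 subr0 normr0 mulr0.
have yx0 : y - x != 0 by rewrite subr_eq0.
have := fr (y - x); rewrite /= sub0r normrN => /(_ yx yx0).
rewrite /GRing.scale/= mulr1 subrK => h.
have -> : f y - f x - d * (y - x) = - (d - (y - x)^-1 * (f y - f x)) * (y - x).
  by field.
by rewrite normrM normrN ler_wpM2r.
Qed.

(** A form of completeness: at the supremum of the points satisfying [P], the step carries [P] from
    a point slightly to the left to one on the right. Since it jumps across x, no separate passage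
    of [P] to limits is required. *)
Lemma real_induction a b (P : R -> Prop) : a <= b -> P a ->
  (forall x, a <= x <= b -> exists2 r, 0 < r & forall y z,
     a <= y <= x -> x <= z <= b -> x - r < y -> z < x + r -> P y -> P z) ->
  P b.
Proof.
move=> ab Pa step; pose S := [set y | a <= y <= b /\ P y].
have Sa : S a by split; rewrite ?lexx.
have Sub : ubound S b by move=> y [/andP[]].
have hS : has_sup S by split; [exists a|exists b].
have sa : a <= sup S by apply: ub_le_sup => //; exists b.
have sb : sup S <= b by apply: ge_sup => //; exists a.
have [|r r0 rstep] := step (sup S); first by rewrite sa sb.
have [y [/andP[ay yb] Py] ysr] := sup_adherent r0 hS.
have ys : y <= sup S by apply: ub_le_sup => //; [exists b|split=> //; rewrite ay yb].
(* Unless [z] is [b], it satisfies [P] and yet lies beyond the supremum. *)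
pose z := Num.min b (sup S + r / 2).
have Pz : P z.
  apply: (rstep y) Py; [by rewrite ay ys| |exact: ysr|].
    by rewrite /z le_min sb ge_min lexx andbT; lra.
  by rewrite /z gt_min; apply/orP; right; lra.
have zs : z <= sup S.
  apply: ub_le_sup; first by exists b.
  split=> //; rewrite /z ge_min lexx/= andbT le_min ab (le_trans sa)//.
  by lra.
suff <- : z = b by [].
move: zs; rewrite /z /Order.min; case: ifP => // _; lra.
Qed.

End RealDerivative.

(** * Absolutely continuous functions with null derivative *)

Section AbsoluteContinuity.
Context (R : realType).
Implicit Types (a b x d e : R) (f g : R -> R).
Notation mu := (@lebesgue_measure R).

(* Cover the exceptional null set by an open set of small measure: near its
   points the increments of f are controlled by absolute continuity, near the
   other points by the vanishing derivative, and [real_induction] propagates the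
   resulting bound from a to b. *)
Lemma abs_cont_deriv0 a b f : a <= b -> real_abs_cont a b f ->
  {ae mu, forall x, a <= x <= b -> real_deriv_in a b f x 0} ->
  f b = f a.
Proof.
move=> ab fac [N [mN N0 fN]].
apply/eqP; rewrite -subr_eq0 -normr_le0; apply/ler_addgt0Pl => e0 e00.
rewrite addr0.
(* The slope [e] costs at most [e * (b - a)] in the derivative part, and the part covered by [U]
   costs another [e]; together they give [e0]. *)
pose e := e0 / (b - a + 1).
have ba0 : 0 < b - a + 1 by lra.
have e_gt0 : 0 < e by rewrite divr_gt0.
have {e00} -> : e0 = e * (b - a) + e by rewrite /e; field; rewrite gt_eqF.
have [d d0 fd] := fac e e_gt0.
have muN : (mu N < +oo)%E by rewrite N0 ltry.
have [U [oU NU Ud]] := lebesgue_regularity_outer mN muN d0.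
have mU : measurable U by exact: open_measurable.
have {Ud} Ud : (mu U < d%:E)%E.
  rewrite -(setDUK NU) measureU//; last 2 first.
    exact: measurableD.
    by rewrite setDE setICA setICr setI0.
  rewrite [X in (X + _)%R](_ : _ = 0); last exact: N0.
  by rewrite [X in (X < _)%E]add0e.
(* [L] lists disjoint intervals, rightmost first, whose increments are left to absolute continuity;
   the rest of [a, x] is paid for by the slope [e]. The measure clause keeps the total length below
   [d]. *)
pose P x := exists L : seq (R * R),
  [/\ all (fun p => (a <= p.1 <= p.2) && (p.2 <= x)) L,
      pairwise (fun p q => q.2 <= p.1) L,
      ((\sum_(p <- L) (p.2 - p.1))%:E <= mu (U `&` `]a, x]))%E &
      `|f x - f a| <= e * (x - a) + \sum_(p <- L) `|f p.2 - f p.1|].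
have : P b.
  apply: (real_induction ab).
    exists [::]; split => //; first by rewrite big_nil measure_ge0.
    by rewrite !subrr normr0 mulr0 add0r big_nil.
  move=> x xab; have [Nx|Nx] := pselect (N x); last first.
    have {}Nx : real_deriv_in a b f x 0.
      by apply: contrapT => h; apply: Nx; apply: fN => /= H; exact/h/H.
    (* Off the null set the list is kept: the increments from y to x and from x to z are both
       bounded by the slope [e]. *)
    have /real_deriv_inP/(_ e e_gt0)[r r0 fr] := Nx.
    exists r => // y z /andP[ay yx] /andP[xz zb] xry zxr [L [La Lp Lm Lf]].
    exists L; split => //.
    - apply: sub_all La => p /andP[-> /=] /le_trans; apply.
      by rewrite (le_trans yx).
    - apply: le_trans Lm _; apply: le_measure; rewrite ?inE; [exact: measurableI..|].
      apply: setIS => t/=; rewrite !in_itv/= => /andP[-> /=] /le_trans; apply.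
      by rewrite (le_trans yx).
    - have h1 : `|f y - f x| <= e * (x - y).
        have := fr y; rewrite mul0r subr0 ay (le_trans yx (proj2 (andP xab))).
        rewrite [`|y - x|]distrC [`|x - y|]ger0_norm ?subr_ge0// ; apply => //; lra.
      have h2 : `|f z - f x| <= e * (z - x).
        have := fr z; rewrite mul0r subr0 zb (le_trans (proj1 (andP xab)) xz).
        rewrite [`|z - x|]ger0_norm ?subr_ge0//; apply => //; lra.
      have -> : f z - f a = (f z - f x) - (f y - f x) + (f y - f a) by ring.
      rewrite (le_trans (ler_normD _ _))//.
      rewrite (le_trans (lerD (ler_normB _ _) Lf))//; lra.
  (* At a point of the null set, the interval from y to z lies in the open set [U] and is put at the
     head of the list. *)
  have /(NU x) Ux := Nx.
  move: oU => /(_ x Ux); rewrite /nbhs/= => -[r /= r0 rU]; exists r => //.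
  move=> y z /andP[ay yx] /andP[xz zb] xry zxr [L [La Lp Lm Lf]].
  have yz := le_trans yx xz.
  exists ((y, z) :: L); split => /=.
  - rewrite ay yz lexx/=; apply: sub_all La => p /andP[-> /=].
    by move=> /le_trans; apply.
  - by rewrite Lp andbT; apply: sub_all La => p /andP[].
  - rewrite big_cons/=.
    have yzU : `]y, z] `<=` U.
      move=> t/=; rewrite in_itv/= => /andP[yt tz]; apply: rU => /=.
      by rewrite ltr_norml; lra.
    have myz : mu `]y, z] = (z - y)%:E.
      by rewrite lebesgue_measure_itv/= lte_fin; case: ltgtP yz => // -> _; rewrite subrr.
    have -> : U `&` `]a, z] = (U `&` `]a, y]) `|` `]y, z].
      apply/seteqP; split => t /=; rewrite !in_itv/=.
        move=> [Ut /andP[at_ tz]]; have [ty|yt] := leP t y; [left|right].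
          by rewrite at_.
        by [].
      move=> [[Ut /andP[at_ ty]]|/andP[yt tz]]; split => //.
      - by rewrite at_ (le_trans ty).
      - by apply: yzU; rewrite /= in_itv/= yt.
      - by rewrite (le_lt_trans ay).
    rewrite measureU//; last 2 first.
      exact: measurableI.
      apply/seteqP; split => t //=; rewrite !in_itv/= => -[[_ /andP[_ ty]] /andP[yt _]]; by move: (le_lt_trans ty yt); rewrite ltxx.
    by rewrite addrC EFinD; apply: leeD Lm _; rewrite -myz.
  - rewrite big_cons/=.
    have -> : f z - f a = (f z - f y) + (f y - f a) by ring.
    rewrite (le_trans (ler_normD _ _))//.
    have : e * (y - a) <= e * (z - a) by rewrite ler_pM2l// lerB.
    move: Lf; lra.
move=> [L [La Lp Lm Lf]].
(* The lengths in [L] add up to at most the measure of [U], which is below [d], so the increments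
   over [L] add up to less than [e]. *)
rewrite (le_trans Lf)// lerD2l ltW//.
have Lad k : (k < size L)%N -> let p := nth (0, 0) L k in
    (a <= p.1 <= p.2) && (p.2 <= b).
  by move=> kL; apply: (allP La); exact: mem_nth.
rewrite (big_nth (0, 0)) big_mkord; apply: fd.
- by move=> k; apply/andP; exact: Lad.
- move=> k l; rewrite -val_eqE neq_ltn => /orP[kl|lk]; [right|left].
    by apply: (pairwiseP (0, 0) Lp); rewrite ?inE ?ltn_ord.
  by apply: (pairwiseP (0, 0) Lp); rewrite ?inE ?ltn_ord.
- rewrite -lte_fin -(big_mkord xpredT (fun k => (nth (0, 0) L k).2 - (nth (0, 0) L k).1)).
  rewrite -(big_nth (0, 0) xpredT (fun p => p.2 - p.1)).
  apply: le_lt_trans Lm _; apply: le_lt_trans Ud.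
  by apply: le_measure; rewrite ?inE//; apply: measurableI.
Qed.

End AbsoluteContinuity.

(** * Closure properties of absolute continuity *)

Section AbsoluteContinuityAlgebra.
Context (R : realType).
Implicit Types (a b x d e : R) (f g : R -> R).
Notation mu := (@lebesgue_measure R).

Lemma real_abs_cont_subset a b a' b' f : a <= a' -> b' <= b ->
  real_abs_cont a b f -> real_abs_cont a' b' f.
Proof.
move=> aa bb fac e /fac[d d0 fd]; exists d => // N s t st; apply: fd => k.
by have [/andP[ask ->] tb] := st k; rewrite (le_trans aa)//= (le_trans tb).
Qed.

Lemma real_abs_cont_uniform a b f : real_abs_cont a b f ->
  forall e, 0 < e -> exists2 d, 0 < d &
    forall x y, a <= x <= b -> a <= y <= b -> `|x - y| < d -> `|f x - f y| < e.
Proof.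
move=> fac e /fac[d d0 fd]; exists d => // x y.
wlog yx : x y / y <= x.
  by move=> H; have [/H//|/ltW/H h xab yab] := leP y x; rewrite distrC [`|f x - _|]distrC; apply: h.
move=> /andP[ax xb] /andP[ay yb].
rewrite ger0_norm ?subr_ge0// => xyd.
have := fd 1%N (fun=> y) (fun=> x); rewrite !big_ord1; apply => //.
  by move=> k; rewrite ay.
by move=> k l; rewrite !ord1 eqxx.
Qed.


(** Uniform continuity lets a bound grow by at most 1 over a step of fixed length; [real_induction]
    chains these steps up to b. *)
Lemma real_abs_cont_bounded a b f : real_abs_cont a b f ->
  exists2 K, 0 < K & forall x, a <= x <= b -> `|f x| <= K.
Proof.
move=> fac; have [ab|ba] := leP a b; last first.
  exists 1 => // x /andP[ax xb]; have := le_lt_trans (le_trans ax xb) ba.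
  by rewrite ltxx.
have [d d0 fd] := real_abs_cont_uniform fac (@ltr01 R).
pose P x := exists2 K, 0 < K & forall y, a <= y <= x -> `|f y| <= K.
apply: (@real_induction R a b P ab).
  exists (`|f a| + 1); first by rewrite ltr_wpDl.
  by move=> y; rewrite -eq_le => /eqP <-; rewrite lerDl.
move=> x xab; exists (d / 2); first by rewrite divr_gt0.
move=> y z /andP[ay yx] /andP[xz zb] xyd zxd [K K0 fK].
exists (K + 1); first by rewrite ltr_wpDr.
move=> t /andP[at_ tz]; have [ty|yt] := leP t y.
  by rewrite (le_trans (fK t _)) ?at_// lerDl.
have -> : f t = (f t - f y) + f y by ring.
rewrite (le_trans (ler_normD _ _))// addrC lerD ?fK ?ay ?lexx// ltW// fd//.
- by rewrite at_ (le_trans tz).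
- by rewrite ay (le_trans yx)// (le_trans xz).
- rewrite ger0_norm; lra.
Qed.

Lemma real_abs_contD a b f g : real_abs_cont a b f -> real_abs_cont a b g ->
  real_abs_cont a b (fun x => f x + g x).
Proof.
move=> fac gac e e0; have e20 : 0 < e / 2 by rewrite divr_gt0.
have [d1 d10 fd] := fac _ e20; have [d2 d20 gd] := gac _ e20.
exists (Num.min d1 d2); first by rewrite lt_min d10.
move=> N s t st dis; rewrite lt_min => /andP[h1 h2].
have -> : e = e / 2 + e / 2 by lra.
apply: le_lt_trans (ltrD (fd N s t st dis h1) (gd N s t st dis h2)).
rewrite -big_split/=; apply: ler_sum => k _.
apply: le_trans (ler_normD _ _); rewrite le_eqVlt; apply/orP; left.
by apply/eqP; congr `|_|; ring.
Qed.

Lemma real_abs_contN a b f : real_abs_cont a b f ->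
  real_abs_cont a b (fun x => - f x).
Proof.
move=> fac e /fac[d d0 fd]; exists d => // N s t st dis h.
apply: le_lt_trans (fd N s t st dis h); apply: ler_sum => k _.
by rewrite -opprD normrN.
Qed.

Lemma real_abs_cont_cst a b c : real_abs_cont a b (fun=> c).
Proof.
move=> e e0; exists 1 => // N s t _ _ _; rewrite big1// => k _.
by rewrite subrr normr0.
Qed.

Lemma real_abs_contM a b f g : real_abs_cont a b f -> real_abs_cont a b g ->
  real_abs_cont a b (fun x => f x * g x).
Proof.
move=> fac gac e e0.
have [K1 K10 fK] := real_abs_cont_bounded fac.
have [K2 K20 gK] := real_abs_cont_bounded gac.
(* The tolerance for each factor is divided by a bound for the other one, since the increment of the
   product splits as g(t) (f(t) - f(s)) + f(s) (g(t) - g(s)). *)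
have e1 : 0 < e / (2 * K2) by rewrite divr_gt0// mulr_gt0.
have e2 : 0 < e / (2 * K1) by rewrite divr_gt0// mulr_gt0.
have [d1 d10 fd] := fac _ e1; have [d2 d20 gd] := gac _ e2.
exists (Num.min d1 d2); first by rewrite lt_min d10.
move=> N s t st dis; rewrite lt_min => /andP[h1 h2].
have -> : e = K2 * (e / (2 * K2)) + K1 * (e / (2 * K1)).
  by field; rewrite !gt_eqF.
have := fd N s t st dis h1; rewrite -(ltr_pM2l K20) => hf.
have := gd N s t st dis h2; rewrite -(ltr_pM2l K10) => hg.
apply: le_lt_trans (ltrD hf hg).
rewrite !mulr_sumr -big_split/=; apply: ler_sum => k _.
have [/andP[ask skt] tkb] := st k.
have -> : f (t k) * g (t k) - f (s k) * g (s k) =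
  g (t k) * (f (t k) - f (s k)) + f (s k) * (g (t k) - g (s k)) by ring.
rewrite (le_trans (ler_normD _ _))// !normrM lerD// ler_wpM2r//.
  by rewrite gK// tkb (le_trans ask).
by rewrite fK// ask (le_trans skt).
Qed.

End AbsoluteContinuityAlgebra.

(** * Primitives of integrable functions *)

Section Primitive.
Context (R : realType).
Implicit Types (a b x d e : R) (f g : R -> R).
Notation mu := (@lebesgue_measure R).

Lemma real_abs_cont_measurable a b f : real_abs_cont a b f ->
  measurable_fun [set` `[a, b]] f.
Proof.
move=> fac; apply: subspace_continuous_measurable_fun => //.
apply/subspace_continuousP => x /=; rewrite in_itv/= => xab.
apply/cvgrPdist_lt => e e0.
have [d d0 fd] := real_abs_cont_uniform fac e0.
by exists d => //= y yx; rewrite /= in_itv/= => yab; exact: fd.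
Qed.

(** Integrating from minus infinity avoids carrying a base point: coefficients on an edge are
    extended by zero, so the primitive vanishes up to the left endpoint. *)
Definition prim f x : R := \int[mu]_(t in [set` `]-oo, x]]) f t.

Lemma prim_diff f x y : mu.-integrable setT (EFin \o f) -> x <= y ->
  prim f y - prim f x = \int[mu]_(t in [set` `]x, y]]) f t.
Proof.
move=> intf xy; rewrite /prim Rintegral_itvB//.
exact: integrableS intf.
Qed.

Lemma prim_eq0 f a : mu.-integrable setT (EFin \o f) ->
  (forall t, t < a -> f t = 0) -> forall x, x <= a -> prim f x = 0.
Proof.
move=> intf f0 x xa; rewrite /prim -Rintegral_itv_bndo_bndc; last first.
  exact: integrableS intf.
rewrite (@eq_Rintegral _ _ _ _ _ (cst 0)).
  by rewrite /Rintegral integral0_eq.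
move=> t; rewrite inE/= in_itv/= => tx.
by rewrite f0// (lt_le_trans tx).
Qed.

(** The absolute continuity of the integral, applied to the disjoint union of the half-open
    intervals ]s k, t k]. *)
Lemma prim_ac f a b : mu.-integrable setT (EFin \o f) ->
  real_abs_cont a b (prim f).
Proof.
move=> intf e /(integral_normr_continuous intf)[d [d0 fd]]; exists d => // N s t st dis h.
pose F (k : 'I_N) := [set` `]s k, t k]].
have mF k : measurable (F k) by exact: measurable_itv.
have tF : trivIset setT F.
  apply/trivIsetP => k l _ _ kl; apply/seteqP; split => x //=.
  rewrite /F/= !in_itv/= => -[/andP[skx xtk] /andP[slx xtl]].
  have [tksl|tlsk] := dis k l kl.
    by have := le_lt_trans (le_trans xtk tksl) slx; rewrite ltxx.
  by have := le_lt_trans (le_trans xtl tlsk) skx; rewrite ltxx.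
pose D := \big[setU/set0]_(k < N) F k.
have mD : measurable D by exact: bigsetU_measurable.
have DE : mu D = (\sum_(k < N) (t k - s k))%:E.
  rewrite /D measure_bigsetU_ord//= -sumEFin; apply: eq_bigr => k _.
  have [/andP[_ stk] _] := st k.
  by rewrite lebesgue_measure_itv/= lte_fin; case: ltgtP stk => // -> _; rewrite subrr.
have iD A : measurable A -> mu.-integrable A (EFin \o (fun x => `|f x|)).
  by move=> mA; apply: integrable_norm; apply: integrableS intf.
have -> : \sum_(k < N) `|prim f (t k) - prim f (s k)| =
          \sum_(k < N) `|\int[mu]_(x in F k) f x|.
  by apply: eq_bigr => k _; rewrite prim_diff//; have [/andP[]] := st k.
have muD : (mu D < d%:E)%E by rewrite DE lte_fin.
apply: le_lt_trans (fd D mD muD).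
have -> : \int[mu]_(x in D) `|f x| = \sum_(k < N) \int[mu]_(x in F k) `|f x|.
  rewrite /Rintegral integral_bigsetU_EFin//=; last first.
  - by have /integrableP[] := iD D mD.
  - by apply: sub_trivIset tF.
  - exact: index_enum_uniq.
  rewrite sum_fine// => k _.
  by apply: (@integrable_fin_num _ _ _ mu (F k) (mF k)); exact: (iD _ (mF k)).
apply: ler_sum => k _; apply: le_normr_Rintegral; first exact: mF.
exact: (@integrableS _ _ _ mu setT (F k) _ measurableT (mF k) (@subsetT _ _) intf).
Qed.

(** Lebesgue differentiation. The exceptional null set is common to all intervals [a, b]. *)
Lemma prim_deriv f : mu.-integrable setT (EFin \o f) ->
  {ae mu, forall x, forall a b, real_deriv_in a b (prim f) x (f x)}.
Proof.
move=> intf; have := @FTC1Ny R f.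
have h1 y : mu.-integrable `]-oo, y] (EFin \o f) by exact: integrableS intf.
have h2 := open_integrable_locally openT intf.
move=> /(_ h1 h2)/=; apply: filterS; first exact: (ae_filter_ringOfSetsType mu).
move=> x [dF <-] a b.
exact: derivable_real_deriv_in.
Qed.

(** Serves to obtain u' = p at every point of an edge, endpoints included, where an almost
    everywhere statement would be too weak. Agreement on ]a, b] is what extension by zero provides
    up to the edge, and the integrals over ]y, z] never see the point a. *)
Lemma prim_deriv_cont f g a b : mu.-integrable setT (EFin \o f) ->
  real_abs_cont a b g -> (forall x, a < x <= b -> f x = g x) ->
  forall x, a <= x <= b -> real_deriv_in a b (prim f) x (g x).
Proof.
move=> intf gac fg x /andP[ax xb]; apply/real_deriv_inP => e e0.
have [d d0 gd] := real_abs_cont_uniform gac e0; exists d => //.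
(* An ordered pair near x covers both signs of y - x: the integrand differs from [g x] by less than
   [e] between the two points. *)
have key y z : a <= y -> y <= z -> z <= b -> `|y - x| < d -> `|z - x| < d ->
    `|prim f z - prim f y - g x * (z - y)| <= e * (z - y).
  move=> ay yz zb yx zx.
  have iyz : mu.-integrable [set` `]y, z]] (EFin \o f) by exact: integrableS intf.
  have icst c : mu.-integrable [set` `]y, z]] (EFin \o cst c).
    apply: measurable_bounded_integrable => //.
      by rewrite [X in (X < _)%E]lebesgue_measure_itv/=; case: ifP => _; rewrite ltry.
    by exists `|c|; split; [exact: num_real|move=> M cM t _; exact: ltW].
  have myz : fine (mu `]y, z]) = z - y.
    rewrite lebesgue_measure_itv/= lte_fin; case: ltgtP yz => //= -> _.
    by rewrite subrr.
  rewrite prim_diff// -myz -(Rintegral_cst mu (measurable_itv `]y, z])).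
  rewrite -RintegralB//; last exact: (icst (g x)).
  rewrite -(Rintegral_cst mu (measurable_itv `]y, z])).
  apply: le_trans; first apply: le_normr_Rintegral => //.
    exact: (integrableB _ iyz (icst (g x))).
  apply: le_Rintegral => //.
    apply: integrable_norm.
    exact: (integrableB _ iyz (icst (g x))).
    exact: (icst e).
  move=> t /=; rewrite in_itv/= => /andP[yt tz].
  rewrite fg ?(le_lt_trans ay yt) ?(le_trans tz)// ltW// gd//.
  - by rewrite (le_trans ay (ltW yt)) (le_trans tz).
  - by rewrite ax.
  - move: yx zx; rewrite !ltr_norml; lra.
move=> y /andP[ay yb] yx.
have xx : `|x - x| < d by rewrite subrr normr0.
have [xy|yx'] := leP x y.
  by rewrite (ger0_norm (_ : 0 <= y - x)) ?subr_ge0//; exact: key.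
rewrite (ltr0_norm (_ : y - x < 0)) ?subr_lt0//.
have -> : prim f y - prim f x - g x * (y - x) =
  - (prim f x - prim f y - g x * (x - y)) by ring.
rewrite normrN opprB; apply: key => //; exact: ltW.
Qed.

End Primitive.

(** * Bounded measurable factors and powers of primitives *)

Section BoundedMeasurable.
Context (R : realType).
Implicit Types (a b x : R) (f g h : R -> R).
Notation mu := (@lebesgue_measure R).

(** The class in which the Picard iterates live: it contains primitives, and its products with
    integrable coefficients are integrable. *)
Definition bounded_measurable h :=
  measurable_fun setT h /\ exists K, forall x, `|h x| <= K.

Lemma integrable_mulr f h : mu.-integrable setT (EFin \o f) ->
  bounded_measurable h -> mu.-integrable setT (EFin \o (fun t => f t * h t)).
Proof.
move=> intf [mh [K hK]].
have hb : [bounded h x | x in setT].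
  exists K; split; first exact: num_real.
  by move=> M KM x _; exact: le_trans (hK x) (ltW KM).
have := @integrableMl _ _ _ mu setT measurableT (EFin \o f) h intf mh hb.
by apply: eq_integrable => // x _ /=; rewrite EFinM.
Qed.

Lemma integrable_bigsum (I : finType) (F : I -> R -> R) :
  (forall i, mu.-integrable setT (EFin \o F i)) ->
  mu.-integrable setT (EFin \o (fun t => \sum_i F i t)).
Proof.
move=> iF.
have := @integrable_sum _ _ _ mu setT measurableT I (index_enum I) xpredT
  (fun i => EFin \o F i) (fun i _ => iF i).
by apply: eq_integrable => // x _ /=; rewrite sumEFin.
Qed.

Lemma prim_le f g x : mu.-integrable setT (EFin \o f) ->
  mu.-integrable setT (EFin \o g) -> (forall t, `|f t| <= g t) ->
  `|prim f x| <= prim g x.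
Proof.
move=> intf intg fg; rewrite /prim.
have iS (k : R -> R) : mu.-integrable setT (EFin \o k) ->
    mu.-integrable [set` `]-oo, x]] (EFin \o k).
  by move=> ik; apply: integrableS ik.
apply: le_trans; first by apply: le_normr_Rintegral => //; exact: iS.
by apply: le_Rintegral => //; [apply: integrable_norm; exact: iS|exact: iS].
Qed.

Lemma prim_le_total g x : mu.-integrable setT (EFin \o g) ->
  (forall t, 0 <= g t) -> prim g x <= \int[mu]_t g t.
Proof.
move=> intg g0; rewrite /prim /Rintegral; apply: fine_le.
- apply: integrable_fin_num => //; exact: integrableS intg.
- exact: integrable_fin_num.
- apply: ge0_subset_integral => //=.
  + by case/integrableP : intg.
  + by move=> t _; rewrite lee_fin.
Qed.

Lemma prim_bounded_measurable f : mu.-integrable setT (EFin \o f) ->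
  bounded_measurable (prim f).
Proof.
move=> intf; split.
  apply: continuous_measurable_fun => x.
  apply/cvgrPdist_lt => e e0.
  have [d d0 fd] := real_abs_cont_uniform (prim_ac (x - 1) (x + 1) intf) e0.
  exists (Num.min d 1); first by rewrite /= lt_min d0/=.
  move=> y /=; rewrite lt_min => /andP[yd y1]; apply: fd => //; first by lra.
  by move: y1; rewrite ltr_norml; lra.
exists (\int[mu]_t `|f t|) => x.
have inf : mu.-integrable setT (EFin \o (fun t => `|f t|)).
  exact: (integrable_norm intf).
apply: le_trans (prim_le_total x inf _); last by [].
exact: prim_le.
Qed.

Lemma real_deriv_inX a b f x d n : real_deriv_in a b f x d ->
  real_deriv_in a b (fun y => f y ^+ n.+1) x (n.+1%:R * (d * f x ^+ n)).
Proof.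
move=> fd; elim: n => [|n ih].
  by rewrite expr0 mulr1 mul1r.
have -> : n.+2%:R * (d * f x ^+ n.+1) =
    d * f x ^+ n.+1 + f x * (n.+1%:R * (d * f x ^+ n)).
  by rewrite [n.+2%:R]mulrS !exprS; ring.
have -> : (fun y => f y ^+ n.+2) = (fun y => f y * f y ^+ n.+1).
  by apply/funext => y; rewrite exprS.
exact: real_deriv_inM.
Qed.

Lemma real_abs_contX a b f n : real_abs_cont a b f ->
  real_abs_cont a b (fun y => f y ^+ n).
Proof.
move=> fac; elim: n => [|n ih]; first exact: real_abs_cont_cst.
have -> : (fun y => f y ^+ n.+1) = (fun y => f y * f y ^+ n).
  by apply/funext => y; rewrite exprS.
exact: real_abs_contM.
Qed.

Lemma bounded_measurableX h n : bounded_measurable h ->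
  bounded_measurable (fun t => h t ^+ n).
Proof.
move=> [mh [K hK]]; split; first exact: measurable_funX.
by exists (K ^+ n) => x; rewrite normrX lerXn2r// nnegrE (le_trans _ (hK x)).
Qed.

(** Both sides are absolutely continuous, vanish at a, and have derivative q Q^n almost everywhere,
    with Q the primitive of q. This integral produces the factorials in the Picard estimate. *)
Lemma prim_pow (q : R -> R) a n x : mu.-integrable setT (EFin \o q) ->
  (forall t, t < a -> q t = 0) ->
  prim (fun t => q t * prim q t ^+ n) x = prim q x ^+ n.+1 / n.+1%:R.
Proof.
move=> iq q0.
have iqn : mu.-integrable setT (EFin \o (fun t => q t * prim q t ^+ n)).
  apply: integrable_mulr => //; apply: bounded_measurableX.
  exact: prim_bounded_measurable.
have at_a y : y <= a -> prim (fun t => q t * prim q t ^+ n) y =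
    prim q y ^+ n.+1 / n.+1%:R.
  move=> ya; rewrite (prim_eq0 iqn _ ya); last by move=> t /q0 ->; rewrite mul0r.
  by rewrite (prim_eq0 iq q0 ya) expr0n/= mul0r.
have [xa|ax] := leP x a; first exact: at_a.
pose F y := prim (fun t => q t * prim q t ^+ n) y + - (n.+1%:R^-1 * prim q y ^+ n.+1).
have : F x = F a.
  apply: abs_cont_deriv0; first exact: ltW.
    apply: real_abs_contD; first exact: prim_ac.
    apply: real_abs_contN; apply: real_abs_contM; first exact: real_abs_cont_cst.
    by apply: real_abs_contX; exact: prim_ac.
  have := prim_deriv iq; have := prim_deriv iqn.
  apply: filterS2; first exact: (ae_filter_ringOfSetsType mu).
  move=> y /(_ a x) d1 /(_ a x) d2 _.
  rewrite [X in real_deriv_in _ _ _ _ X](_ : _ = q y * prim q y ^+ n +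
    - (0 * prim q y ^+ n.+1 + n.+1%:R^-1 * (n.+1%:R * (q y * prim q y ^+ n)))).
    apply: real_deriv_inD => //; apply: real_deriv_inN.
    apply: (@real_deriv_inM _ _ _ (fun=> _)); first exact: real_deriv_in_cst.
    exact: real_deriv_inX.
  by rewrite mul0r add0r mulKf ?pnatr_eq0// subrr.
have -> : F a = 0 by rewrite /F (at_a a)// mulrC subrr.
rewrite /F => /eqP; rewrite subr_eq0 => /eqP ->.
by rewrite mulrC.
Qed.

End BoundedMeasurable.

(** * Picard iteration for linear systems with integrable coefficients *)

Section Picard.
Context (R : realType) (I : finType) (A : I -> I -> R -> R) (a : R) (y0 : I -> R).
Notation mu := (@lebesgue_measure R).
Hypothesis intA : forall k l, mu.-integrable setT (EFin \o A k l).
Hypothesis A0 : forall k l t, t < a -> A k l t = 0.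

(** Summing over all entries gives a single scalar function that dominates every row of the
    system. *)
Let q t := \sum_k \sum_l `|A k l t|.
Let C := \sum_k `|y0 k|.
Let M := \int[mu]_t q t.

Fixpoint picard r : I -> R -> R := if r is r'.+1 then
  fun k x => y0 k + prim (fun t => \sum_l A k l t * picard r' l t) x
  else fun k _ => y0 k.

Let C_ge0 : 0 <= C. Proof. exact: sumr_ge0. Qed.
Let q_ge0 t : 0 <= q t.
Proof. by apply: sumr_ge0 => k _; apply: sumr_ge0. Qed.
Let q0 t : t < a -> q t = 0.
Proof.
by move=> ta; rewrite /q big1// => k _; rewrite big1// => l _; rewrite A0// normr0.
Qed.
Let int_q : mu.-integrable setT (EFin \o q).
Proof.
apply: (@integrable_bigsum _ _ (fun k t => \sum_l `|A k l t|)) => k.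
apply: (@integrable_bigsum _ _ (fun l t => `|A k l t|)) => l.
exact: (integrable_norm (intA k l)).
Qed.

Let bm_sum (w : I -> R -> R) k : (forall l, bounded_measurable (w l)) ->
  mu.-integrable setT (EFin \o (fun t => \sum_l A k l t * w l t)).
Proof.
move=> bw; apply: (@integrable_bigsum _ _ (fun l t => A k l t * w l t)) => l.
exact: integrable_mulr.
Qed.

Let bm_step (c : R) f : mu.-integrable setT (EFin \o f) ->
  bounded_measurable (fun x => c + prim f x).
Proof.
move=> intf; have [mf [K fK]] := prim_bounded_measurable intf; split.
  exact: measurable_funD.
by exists (`|c| + K) => x; rewrite (le_trans (ler_normD _ _))// lerD2l.
Qed.

Let bm_cst (c : R) : bounded_measurable (fun=> c).
Proof. by split; [exact: measurable_cst|exists `|c|]. Qed.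

Let picard_bm r k : bounded_measurable (picard r k).
Proof.
elim: r k => [|r ih] k; first exact: bm_cst.
by apply: bm_step; apply: bm_sum.
Qed.

Let sum_le (w : I -> R -> R) (m : R) k t : 0 <= m -> (forall l, `|w l t| <= m) ->
  `|\sum_l A k l t * w l t| <= q t * m.
Proof.
move=> m0 wm; rewrite (le_trans (ler_norm_sum _ _ _))//.
have h : \sum_l `|A k l t * w l t| <= \sum_l `|A k l t| * m.
  by apply: ler_sum => l _; rewrite normrM ler_wpM2l.
rewrite (le_trans h)// -mulr_suml ler_wpM2r//.
by rewrite /q [leRHS](bigD1 k)//= lerDl; apply: sumr_ge0 => ? _; apply: sumr_ge0.
Qed.

Let Q_ge0 x : 0 <= prim q x.
Proof. by apply: Rintegral_ge0. Qed.

(** By induction on r: the difference of consecutive iterates is the primitive of [A] applied to the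
    previous difference, hence at most the primitive of q Q^(r+1) up to a constant, and [prim_pow]
    evaluates it. *)
Let picard_diff r k x :
  `|picard r.+1 k x - picard r k x| <= C * (prim q x ^+ r.+1 / r.+1`!%:R).
Proof.
have iqr n : mu.-integrable setT (EFin \o (fun t => q t * prim q t ^+ n)).
  by apply: integrable_mulr => //; apply/bounded_measurableX/prim_bounded_measurable.
have iqc n c : mu.-integrable setT (EFin \o (fun t => c * (q t * prim q t ^+ n))).
  exact: (integrableZl measurableT c (iqr n)).
have prim_iqc n c z : prim (fun t => c * (q t * prim q t ^+ n)) z =
    c * (prim q z ^+ n.+1 / n.+1%:R).
  by rewrite -(prim_pow n z int_q q0) /prim RintegralZl//; exact: integrableS (iqr n).
elim: r k x => [|r ih] k x.
  rewrite /= addrC addKr -(prim_iqc 0%N C x); apply: prim_le => //.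
    exact: (bm_sum _ (fun l => bm_cst (y0 l))).
  move=> t; rewrite expr0 mulr1 mulrC; apply: (sum_le (w := fun l _ => y0 l)) => // l.
  by rewrite /C (bigD1 l)//= lerDl; apply: sumr_ge0.
have -> : picard r.+2 k x - picard r.+1 k x =
    prim (fun t => \sum_l A k l t * (picard r.+1 l t - picard r l t)) x.
  rewrite [picard r.+2]/= [picard r.+1 k]/= opprD addrACA subrr add0r.
  rewrite /prim -RintegralB//; last 2 first.
    exact: integrableS (bm_sum k (picard_bm r.+1)).
    exact: integrableS (bm_sum k (picard_bm r)).
  apply: eq_Rintegral => t _; rewrite -sumrB.
  by apply: eq_bigr => l _; rewrite mulrBr.
have -> : C * (prim q x ^+ r.+2 / (r.+2)`!%:R) =
    prim (fun t => C / r.+1`!%:R * (q t * prim q t ^+ r.+1)) x.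
  have alg (c p u v : R) : c * (p / (u * v)) = c / v * (p / u).
    by rewrite invfM; ring.
  by rewrite prim_iqc factS natrM; exact: alg.
apply: prim_le => //.
  apply: bm_sum => l; have [m1 [K1 h1]] := picard_bm r.+1 l.
  have [m2 [K2 h2]] := picard_bm r l.
  split; first exact: measurable_funB.
  by exists (K1 + K2) => t; rewrite (le_trans (ler_normB _ _))// lerD.
move=> t; have -> : C / (r.+1)`!%:R * (q t * prim q t ^+ r.+1) =
    q t * (C * (prim q t ^+ r.+1 / (r.+1)`!%:R)) by ring.
apply: (sum_le (w := fun l t => picard r.+1 l t - picard r l t)) => [|l].
  by rewrite mulr_ge0// divr_ge0// exprn_ge0.
exact: ih.
Qed.

Let M_ge0 : 0 <= M. Proof. exact: Rintegral_ge0. Qed.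

(** Replacing Q(x) by the total mass [M] makes the bound uniform in x and compares it with a term of
    the exponential series. *)
Let picard_diffM r k x :
  `|picard r.+1 k x - picard r k x| <= C * exp_coeff M r.+1.
Proof.
apply: le_trans (picard_diff r k x) _; rewrite ler_wpM2l// /exp_coeff/=.
rewrite ler_wpM2r ?invr_ge0// lerXn2r// ?nnegrE//.
exact: prim_le_total.
Qed.

Let S := limn (series (exp_coeff M)).

(** The differences telescope to partial sums of C exp(M). The bound is uniform in r and x, as
    dominated convergence will require. *)
Let picard_bound r k x : `|picard r k x| <= C * S.
Proof.
have h : `|picard r k x| <= C * series (exp_coeff M) r.+1.
  elim: r => [|r ih].
    rewrite /series/= big_nat1 /exp_coeff/= expr0 fact0 divr1 mulr1.
    by rewrite /C (bigD1 k)//= lerDl; apply: sumr_ge0.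
  have -> : series (exp_coeff M) r.+2 = series (exp_coeff M) r.+1 + exp_coeff M r.+1.
    by rewrite /series/= big_nat_recr.
  rewrite mulrDr.
  have -> : picard r.+1 k x = picard r k x + (picard r.+1 k x - picard r k x) by ring.
  by rewrite (le_trans (ler_normD _ _))// lerD// picard_diffM.
rewrite (le_trans h)// ler_wpM2l//; apply: nondecreasing_cvgn_le.
  by apply: nondecreasing_series => n _ _; exact: exp_coeff_ge0.
exact: is_cvg_series_exp_coeff.
Qed.

Let picard_cvg k x : cvgn (fun r => picard r k x).
Proof.
have -> : (fun r => picard r k x) =
    (fun r => y0 k + series (telescope (fun r => picard r k x)) r).
  by apply/funext => r; exact: (eq_sum_telescope (fun r => picard r k x)).
apply: is_cvgD; first exact: is_cvg_cst.
apply: normed_cvg.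
apply: (@series_le_cvg _ _ (fun r => C * exp_coeff M r.+1)).
- by move=> n /=.
- by move=> n; rewrite mulr_ge0// exp_coeff_ge0.
- by move=> n; exact: picard_diffM.
- have -> : series (fun r => C * exp_coeff M r.+1) =
      (fun n => C * (series (exp_coeff M) n.+1 - 1)).
    apply/funext => n; rewrite /series/= big_nat_recl//= /exp_coeff/= expr0 fact0.
    by rewrite divr1 addrC addKr mulr_sumr.
  apply: is_cvgMl_tmp; apply: is_cvgB; last exact: is_cvg_cst.
  apply/cvg_ex; exists S; rewrite (cvg_shiftS (series (exp_coeff M)) (nbhs S)).
  exact: is_cvg_series_exp_coeff.
Qed.

(** The pointwise limit of the iterates satisfies the integral equation by dominated convergence,
    with the integrable majorant q multiplied by [C * S]. *)
Lemma linear_system_exists : exists y : I -> R -> R,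
  (forall k l, mu.-integrable setT (EFin \o (fun t => A k l t * y l t))) /\
  forall k x, y k x = y0 k + prim (fun t => \sum_l A k l t * y l t) x.
Proof.
pose y k x := limn (fun r => picard r k x).
have ycvg k x : (fun r => picard r k x) @ \oo --> y k x by exact: picard_cvg.
have my k : measurable_fun setT (y k).
  apply: (@measurable_fun_cvg _ _ _ setT (fun r => picard r k)).
    by move=> r; have [] := picard_bm r k.
  by move=> x _; exact: ycvg.
have by_ k : bounded_measurable (y k).
  split=> //; exists (C * S) => x.
  have h : (fun r => `|picard r k x|) @ \oo --> `|y k x| by exact: cvg_norm (ycvg k x).
  rewrite -(cvg_lim _ h)//.
  apply: limr_le; first by apply/cvg_ex; eexists; exact: h.
  by apply: nearW => r; exact: picard_bound.
exists y; split=> [k l|k x]; first exact: integrable_mulr.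
have fr r := bm_sum k (picard_bm r).
have fy := bm_sum k by_.
have ig : mu.-integrable [set` `]-oo, x]] (fun t => (q t * (C * S))%:E).
  have := integrableZl measurableT (C * S) int_q => h.
  rewrite [X in mu.-integrable _ X](_ : _ = (fun t => (C * S)%:E * (EFin \o q) t)%E).
    by apply: integrableS h.
  by apply/funext => t /=; rewrite mulrC EFinM.
have CS0 : 0 <= C * S.
  by case: (pickP (@predT I)) => [l _|]; [exact: le_trans (picard_bound 0 l x)|move=> /(_ k)].
have [] := @dominated_convergence _ _ _ mu [set` `]-oo, x]] (measurable_itv _)
  (fun r t => (\sum_l A k l t * picard r l t)%:E)
  (fun t => (\sum_l A k l t * y l t)%:E) (fun t => (q t * (C * S))%:E).
- move=> r; have /integrableP[+ _] := fr r.
  exact: measurable_funS.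
- have /integrableP[+ _] := fy.
  exact: measurable_funS.
- apply: aeW => t _; apply: cvg_EFin; first by apply: nearW.
  rewrite /=; elim: (index_enum I) => [|l s ih].
    by rewrite big_nil; under eq_fun do rewrite big_nil; exact: cvg_cst.
  rewrite big_cons; under eq_fun do rewrite big_cons.
  by apply: cvgD => //; apply: cvgMl_tmp; exact: ycvg.
- exact: ig.
- apply: aeW => t r _; rewrite /= lee_fin.
  by apply: sum_le => // l; exact: picard_bound.
move=> _ _ cv.
have fin_y : (\int[mu]_(t in `]-oo, x]) (\sum_l A k l t * y l t)%:E)%E \is a fin_num.
  by apply: integrable_fin_num => //; exact: integrableS fy.
have {}cv : (fun r => prim (fun t => \sum_l A k l t * picard r l t) x) @ \oo -->
    prim (fun t => \sum_l A k l t * y l t) x.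
  by apply: fine_cvg; rewrite /prim /Rintegral fineK.
have cv2 : (fun r => picard r.+1 k x) @ \oo -->
    y0 k + prim (fun t => \sum_l A k l t * y l t) x.
  by apply: cvgD => //; exact: cvg_cst.
have cv3 : (fun r => picard r.+1 k x) @ \oo --> y k x.
  by rewrite (cvg_shiftS (fun r => picard r k x) (nbhs (y k x))); exact: ycvg.
by rewrite -(cvg_lim _ cv2)// -(cvg_lim _ cv3).
Qed.

End Picard.

(** * Schroedinger solutions on an edge *)

Section ComplexFunctions.
Local Open Scope complex_scope.
Context (R : realType).
Implicit Types (a b x : R) (f g u p w q : R -> R[i]) (c d lam : R[i]).
Notation mu := (@lebesgue_measure R).

Let ReM c d : complex.Re (c * d) =
  complex.Re c * complex.Re d - complex.Im c * complex.Im d.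
Proof. by case: c d => [? ?] [? ?]. Qed.

Let ImM c d : complex.Im (c * d) =
  complex.Re c * complex.Im d + complex.Im c * complex.Re d.
Proof. by case: c d => [? ?] [? ?]. Qed.

Let ReD c d : complex.Re (c + d) = complex.Re c + complex.Re d.
Proof. by case: c d => [? ?] [? ?]. Qed.

Let ImD c d : complex.Im (c + d) = complex.Im c + complex.Im d.
Proof. by case: c d => [? ?] [? ?]. Qed.

Let ReN c : complex.Re (- c) = - complex.Re c. Proof. by case: c. Qed.
Let ImN c : complex.Im (- c) = - complex.Im c. Proof. by case: c. Qed.

Let ReMf f g : (fun x => complex.Re (f x * g x)) =
  (fun x => complex.Re (f x) * complex.Re (g x) + - (complex.Im (f x) * complex.Im (g x))).
Proof. by apply/funext => x; exact: ReM. Qed.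
Let ImMf f g : (fun x => complex.Im (f x * g x)) =
  (fun x => complex.Re (f x) * complex.Im (g x) + complex.Im (f x) * complex.Re (g x)).
Proof. by apply/funext => x; exact: ImM. Qed.
Let ReDf f g : (fun x => complex.Re (f x + g x)) =
  (fun x => complex.Re (f x) + complex.Re (g x)).
Proof. by apply/funext => x; exact: ReD. Qed.
Let ImDf f g : (fun x => complex.Im (f x + g x)) =
  (fun x => complex.Im (f x) + complex.Im (g x)).
Proof. by apply/funext => x; exact: ImD. Qed.
Let ReNf f : (fun x => complex.Re (- f x)) = (fun x => - complex.Re (f x)).
Proof. by apply/funext => x; exact: ReN. Qed.
Let ImNf f : (fun x => complex.Im (- f x)) = (fun x => - complex.Im (f x)).
Proof. by apply/funext => x; exact: ImN. Qed.

Lemma abs_contD a b f g : abs_cont a b f -> abs_cont a b g ->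
  abs_cont a b (fun x => f x + g x).
Proof.
move=> [f1 f2] [g1 g2]; split.
  rewrite ReDf.
  exact: real_abs_contD.
rewrite ImDf.
exact: real_abs_contD.
Qed.

Lemma abs_contN a b f : abs_cont a b f -> abs_cont a b (fun x => - f x).
Proof.
move=> [f1 f2]; split.
  rewrite ReNf.
  exact: real_abs_contN.
rewrite ImNf.
exact: real_abs_contN.
Qed.

Lemma abs_contM a b f g : abs_cont a b f -> abs_cont a b g ->
  abs_cont a b (fun x => f x * g x).
Proof.
move=> [f1 f2] [g1 g2]; split.
  rewrite ReMf.
  by apply: real_abs_contD; [|apply: real_abs_contN]; exact: real_abs_contM.
rewrite ImMf.
by apply: real_abs_contD; exact: real_abs_contM.
Qed.

Lemma abs_cont_cst a b c : abs_cont a b (fun=> c).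
Proof. by split; exact: real_abs_cont_cst. Qed.

Lemma abs_cont_subset a b a' b' f : a <= a' -> b' <= b ->
  abs_cont a b f -> abs_cont a' b' f.
Proof. by move=> aa bb [? ?]; split; exact: real_abs_cont_subset aa bb _. Qed.

Lemma deriv_inD a b f g x c d : deriv_in a b f x c -> deriv_in a b g x d ->
  deriv_in a b (fun y => f y + g y) x (c + d).
Proof.
move=> [f1 f2] [g1 g2]; split.
  rewrite ReDf.
  rewrite ReD; exact: real_deriv_inD.
rewrite ImDf.
rewrite ImD; exact: real_deriv_inD.
Qed.

Lemma deriv_inN a b f x c : deriv_in a b f x c ->
  deriv_in a b (fun y => - f y) x (- c).
Proof.
move=> [f1 f2]; split.
  rewrite ReNf.
  rewrite ReN; exact: real_deriv_inN.
rewrite ImNf.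
rewrite ImN; exact: real_deriv_inN.
Qed.

Lemma deriv_inM a b f g x c d : deriv_in a b f x c -> deriv_in a b g x d ->
  deriv_in a b (fun y => f y * g y) x (c * g x + f x * d).
Proof.
move=> [f1 f2] [g1 g2]; split.
  rewrite ReMf.
  have -> : complex.Re (c * g x + f x * d) =
    complex.Re c * complex.Re (g x) + complex.Re (f x) * complex.Re d
    + - (complex.Im c * complex.Im (g x) + complex.Im (f x) * complex.Im d).
    by rewrite ReD !ReM; ring.
  apply: real_deriv_inD; first exact: real_deriv_inM.
  by apply: real_deriv_inN; exact: real_deriv_inM.
rewrite ImMf.
have -> : complex.Im (c * g x + f x * d) =
    complex.Re c * complex.Im (g x) + complex.Re (f x) * complex.Im d
    + (complex.Im c * complex.Re (g x) + complex.Im (f x) * complex.Re d).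
  by rewrite ImD !ImM; ring.
by apply: real_deriv_inD; exact: real_deriv_inM.
Qed.

Lemma deriv_in_cst a b c x : deriv_in a b (fun=> c) x 0.
Proof. by split; exact: real_deriv_in_cst. Qed.

Lemma deriv_inZ a b c f x d : deriv_in a b f x d ->
  deriv_in a b (fun y => c * f y) x (c * d).
Proof.
move=> fd; rewrite -[c * d]add0r -(mul0r (f x)).
exact: deriv_inM (deriv_in_cst a b c x) fd.
Qed.

Lemma deriv_in_subset a b a' b' f x d : a <= a' -> b' <= b ->
  deriv_in a b f x d -> deriv_in a' b' f x d.
Proof. by move=> aa bb [? ?]; split; exact: real_deriv_in_subset aa bb _. Qed.

(** The definition of the resolvent set speaks of square integrable right-hand sides; this makes lam
    u admissible for a solution u. *)
Lemma abs_cont_L2 a b f : abs_cont a b f -> L2_on a b f.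
Proof.
move=> [f1 f2]; split; first by split; exact: real_abs_cont_measurable.
have hac := real_abs_contD (real_abs_contX 2 f1) (real_abs_contX 2 f2).
have mh := real_abs_cont_measurable hac.
have [K K0 hK] := real_abs_cont_bounded hac.
have : mu.-integrable [set` `[a, b]]
    (EFin \o (fun x => complex.Re (f x) ^+ 2 + complex.Im (f x) ^+ 2)).
  apply: measurable_bounded_integrable => //.
    by rewrite [X in (X < _)%E]lebesgue_measure_itv/=; case: ifP => _; rewrite ltry.
  exists K; split; first exact: num_real.
  move=> M KM t /=; rewrite in_itv/= => tab.
  by rewrite (le_trans (hK t tab))// ltW.
move=> /integrableP[_]; apply: le_lt_trans; rewrite /L2_sqnorm.
rewrite le_eqVlt; apply/orP; left; apply/eqP; apply: eq_integral => t _ /=.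
by rewrite ger0_norm// addr_ge0// sqr_ge0.
Qed.

(** [solution] on a star unfolds to this on each edge, so results about one interval apply to stars
    directly. *)
Definition edge_solution a b (v : R -> R[i]) lam u p :=
  [/\ abs_cont a b u,
      forall x, a <= x <= b -> deriv_in a b u x (p x),
      abs_cont a b p &
      {ae mu, forall x, a <= x <= b ->
        exists2 d, deriv_in a b p x d & - d + v x * u x = lam * u x}].

Lemma edge_solution_subset a b a' b' v lam u p : a <= a' -> b' <= b ->
  edge_solution a b v lam u p -> edge_solution a' b' v lam u p.
Proof.
move=> aa bb [uac ud pac pd].
have sub x : a' <= x <= b' -> a <= x <= b.
  by move=> /andP[? ?]; apply/andP; split; [exact: le_trans aa _|exact: le_trans bb].
split.
- exact: abs_cont_subset uac.
- by move=> x /sub /ud; exact: deriv_in_subset.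
- exact: abs_cont_subset pac.
- move: pd; apply: filterS; first exact: (ae_filter_ringOfSetsType mu).
  move=> x xd /sub /xd[d pd]; exists d => //.
  exact: deriv_in_subset pd.
Qed.

Lemma edge_solution_lin a b v lam c d u p w q :
  edge_solution a b v lam u p -> edge_solution a b v lam w q ->
  edge_solution a b v lam (fun x => c * u x + d * w x) (fun x => c * p x + d * q x).
Proof.
move=> [uac ud pac pd] [wac wd qac qd]; split.
- by apply: abs_contD; apply: abs_contM => //; exact: abs_cont_cst.
- by move=> x xab; apply: deriv_inD; apply: deriv_inZ; [exact: ud|exact: wd].
- by apply: abs_contD; apply: abs_contM => //; exact: abs_cont_cst.
- move: pd qd; apply: filterS2; first exact: (ae_filter_ringOfSetsType mu).
  move=> x xd xe xab; have [d1 pd1 e1] := xd xab; have [d2 qd2 e2] := xe xab.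
  exists (c * d1 + d * d2); first by apply: deriv_inD; exact: deriv_inZ.
  have -> : - (c * d1 + d * d2) + v x * (c * u x + d * w x) =
    c * (- d1 + v x * u x) + d * (- d2 + v x * w x) by ring.
  by rewrite e1 e2; ring.
Qed.

Lemma edge_solution0 a b v lam : edge_solution a b v lam (fun=> 0) (fun=> 0).
Proof.
split; try exact: abs_cont_cst; first by move=> *; exact: deriv_in_cst.
apply: aeW => x _; exists 0; first exact: deriv_in_cst.
by rewrite !mulr0 oppr0 addr0.
Qed.

(** The Wronskian is absolutely continuous, and in its derivative u w'' - u'' w the terms with v and
    lam cancel almost everywhere. *)
Lemma wronskian_left a b v lam u p w q :
  edge_solution a b v lam u p -> edge_solution a b v lam w q ->
  forall x, a <= x <= b -> u x * q x - p x * w x = u a * q a - p a * w a.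
Proof.
move=> us ws x /andP[ax xb].
(* Restricting to [a, x] makes x an endpoint, as [abs_cont_deriv0] compares the two ends of an
   interval. *)
have [uac ud pac pd] := edge_solution_subset (lexx a) xb us.
have [wac wd qac qd] := edge_solution_subset (lexx a) xb ws.
pose W y := u y * q y + - (p y * w y).
have Wac : abs_cont a x W.
  by apply: abs_contD; [|apply: abs_contN]; exact: abs_contM.
have Wd : {ae mu, forall y, a <= y <= x -> deriv_in a x W y 0}.
  move: pd qd; apply: filterS2; first exact: (ae_filter_ringOfSetsType mu).
  move=> y yd ye yax; have [d1 pd1 e1] := yd yax; have [d2 qd2 e2] := ye yax.
  have -> : (0 : R[i]) = p y * q y + u y * d2 + - (d1 * w y + p y * q y).
    have -> : d1 = v y * u y - lam * u y by rewrite -e1; ring.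
    have -> : d2 = v y * w y - lam * w y by rewrite -e2; ring.
    by ring.
  apply: deriv_inD; first by apply: deriv_inM; [exact: ud|].
  by apply: deriv_inN; apply: deriv_inM => //; exact: wd.
have [W1 W2] := Wac.
apply/eqP; rewrite eq_complex; apply/andP; split; apply/eqP.
  apply: (abs_cont_deriv0 ax W1).
  move: Wd; apply: filterS; first exact: (ae_filter_ringOfSetsType mu).
  by move=> y yd /yd[].
apply: (abs_cont_deriv0 ax W2).
move: Wd; apply: filterS; first exact: (ae_filter_ringOfSetsType mu).
by move=> y yd /yd[].
Qed.

Lemma wronskian_cst a b v lam u p w q x y :
  edge_solution a b v lam u p -> edge_solution a b v lam w q ->
  a <= x <= b -> a <= y <= b ->
  u x * q x - p x * w x = u y * q y - p y * w y.
Proof.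
by move=> us ws xab yab; rewrite (wronskian_left us ws xab) (wronskian_left us ws yab).
Qed.

End ComplexFunctions.

(** * The Cauchy problem on an edge *)

Section Existence.
Local Open Scope complex_scope.
Context (R : realType).
Implicit Types (a b x : R) (v u p w q : R -> R[i]) (c d lam : R[i]).
Notation mu := (@lebesgue_measure R).

Lemma integrable_patch a b (f : R -> R) :
  mu.-integrable [set` `[a, b]] (EFin \o f) ->
  mu.-integrable setT (EFin \o (f \_ [set` `[a, b]])).
Proof.
move=> intf; rewrite -restrict_EFin.
by rewrite -(@integrable_mkcond _ _ _ mu [set` `[a, b]]).
Qed.

Lemma integrable_cst_itv a b (c : R) :
  mu.-integrable [set` `[a, b]] (EFin \o (fun=> c)).
Proof.
apply: measurable_bounded_integrable => //.
  by rewrite [X in (X < _)%E]lebesgue_measure_itv/=; case: ifP => _; rewrite ltry.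
by exists `|c|; split; [exact: num_real|move=> M cM t _; exact: ltW].
Qed.

Let sum_bool2 (F : bool * bool -> R) :
  \sum_l F l = F (true, true) + F (true, false) + (F (false, true) + F (false, false)).
Proof.
rewrite (eq_bigr (fun l : bool * bool => F (l.1, l.2))); last by move=> [].
by rewrite -(pair_bigA _ (fun e1 e2 => F (e1, e2)))/= !big_bool.
Qed.

(** The equation becomes a real first-order system in four unknowns indexed by pairs of booleans:
    the first one selects p rather than u, the second the imaginary rather than the real part. *)
Lemma edge_solution_exists_left a b v lam c0 c1 : a <= b -> L1_on a b v ->
  exists u p, [/\ edge_solution a b v lam u p, u a = c0 & p a = c1].
Proof.
move=> ab [v1 v2].
pose one := (fun _ : R => 1 : R) \_ [set` `[a, b]].
pose qr := (fun x => complex.Re (v x) - complex.Re lam) \_ [set` `[a, b]].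
pose qi := (fun x => complex.Im (v x) - complex.Im lam) \_ [set` `[a, b]].
have ione : mu.-integrable setT (EFin \o one).
  by apply: integrable_patch; exact: integrable_cst_itv.
have iqr : mu.-integrable setT (EFin \o qr).
  by apply: integrable_patch; exact: (integrableB _ v1 (integrable_cst_itv _ _ _)).
have iqi : mu.-integrable setT (EFin \o qi).
  by apply: integrable_patch; exact: (integrableB _ v2 (integrable_cst_itv _ _ _)).
have iqin : mu.-integrable setT (EFin \o (fun x => - qi x)).
  exact: (integrableN iqi).
have i0 : mu.-integrable setT (EFin \o (fun _ : R => 0 : R)).
  exact: (integrable0 mu setT).
(* The system u' = p, p' = (v - lam) u in real coordinates; [qr] and [qi] are the real and imaginary
   parts of v - lam, extended by zero. *)
pose A (k l : bool * bool) : R -> R :=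
  if k.1 then
    if l.1 then fun=> 0 else
    if k.2 == l.2 then qr else if k.2 then qi else fun x => - qi x
  else if l.1 && (k.2 == l.2) then one else fun=> 0.
have iA k l : mu.-integrable setT (EFin \o A k l).
  by rewrite /A; move: k l => [[] []] [[] []].
have out t (f : R -> R) : t < a -> (f \_ [set` `[a, b]]) t = 0.
  move=> ta; rewrite patchE ifF//; apply/negbTE.
  by rewrite notin_setE/= in_itv/= leNgt ta.
have ins t (f : R -> R) : a <= t <= b -> (f \_ [set` `[a, b]]) t = f t.
  by move=> tab; rewrite patchE ifT// inE/= in_itv.
have A0 k l t : t < a -> A k l t = 0.
  move=> ta; rewrite /A; move: k l => [[] []] [[] []] //=;
  by rewrite /one /qr /qi ?(out _ _ ta) ?oppr0.
pose y0 (k : bool * bool) := if k.1 then if k.2 then complex.Im c1 else complex.Re c1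
  else if k.2 then complex.Im c0 else complex.Re c0.
have [y [iy yE]] := linear_system_exists y0 iA A0.
have iF k : mu.-integrable setT (EFin \o (fun t => \sum_l A k l t * y l t)).
  by apply: (@integrable_bigsum _ _ (fun l t => A k l t * y l t)) => l; exact: iy.
have yac k : real_abs_cont a b (y k).
  rewrite (_ : y k = fun x => y0 k + prim (fun t => \sum_l A k l t * y l t) x).
    by apply: real_abs_contD; [exact: real_abs_cont_cst|exact: prim_ac].
  by apply/funext => x; exact: yE.
have ya k : y k a = y0 k.
  rewrite yE (@prim_eq0 _ _ a) ?addr0// => t ta.
  by rewrite big1// => l _; rewrite A0// mul0r.
have yd e x : a <= x <= b -> real_deriv_in a b (y (false, e)) x (y (true, e) x).
  move=> xab; rewrite -[y _ x]add0r.
  rewrite (_ : y (false, e) = fun x => y0 (false, e) +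
     prim (fun t => \sum_l A (false, e) l t * y l t) x); last first.
    by apply/funext => z; exact: yE.
  apply: real_deriv_inD; first exact: real_deriv_in_cst.
  apply: prim_deriv_cont => // t /andP[at_ tb].
  have oneE : one t = 1 by rewrite /one ins ?(ltW at_).
  by rewrite sum_bool2 /A /=; case: e => /=; rewrite oneE; ring.
have pd : {ae mu, forall x, a <= x <= b -> forall e,
    real_deriv_in a b (y (true, e)) x (\sum_l A (true, e) l x * y l x)}.
  move: (prim_deriv (iF (true, true))) (prim_deriv (iF (true, false))).
  apply: filterS2; first exact: (ae_filter_ringOfSetsType mu).
  move=> x d1 d2 xab e; rewrite -[X in real_deriv_in _ _ _ _ X]add0r.
  rewrite (_ : y (true, e) = fun x => y0 (true, e) +
     prim (fun t => \sum_l A (true, e) l t * y l t) x); last first.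
    by apply/funext => z; exact: yE.
  apply: real_deriv_inD; first exact: real_deriv_in_cst.
  by case: e; [exact: d1|exact: d2].
exists (fun x => y (false, false) x +i* y (false, true) x).
exists (fun x => y (true, false) x +i* y (true, true) x).
split; [split|by rewrite !ya; case: c0 @y0 yE ya|by rewrite !ya; case: c1 @y0 yE ya].
- by split; exact: yac.
- by move=> x xab; split; exact: yd.
- by split; exact: yac.
- move: pd; apply: filterS; first exact: (ae_filter_ringOfSetsType mu).
  move=> x xd xab.
  exists ((\sum_l A (true, false) l x * y l x) +i* (\sum_l A (true, true) l x * y l x)).
    by split; exact: xd.
  rewrite !sum_bool2 /A /= /qr /qi !ins//; case: (v x) => vr vi; case: (lam) => lr li.
  by apply/eqP; rewrite eq_complex/=; apply/andP; split; apply/eqP; ring.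
Qed.

(** The basis with Cauchy data (1, 0) and (0, 1) at a has Wronskian 1 at x as well, so the
    coefficients come from Cramer's rule without a denominator. *)
Lemma edge_solution_exists a b v lam x c0 c1 : a <= x <= b -> L1_on a b v ->
  exists u p, [/\ edge_solution a b v lam u p, u x = c0 & p x = c1].
Proof.
move=> xab v1; have ab : a <= b by move: xab => /andP[]; exact: le_trans.
have [f [f' [fs fa fa']]] := edge_solution_exists_left lam 1 0 ab v1.
have [g [g' [gs ga ga']]] := edge_solution_exists_left lam 0 1 ab v1.
have := wronskian_left fs gs xab; rewrite fa fa' ga ga' mul0r mulr1 subr0 => W.
exists (fun y => (c0 * g' x - c1 * g x) * f y + (f x * c1 - f' x * c0) * g y).
exists (fun y => (c0 * g' x - c1 * g x) * f' y + (f x * c1 - f' x * c0) * g' y).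
split; first exact: edge_solution_lin.
  by rewrite -[RHS]mulr1 -W; ring.
by rewrite -[RHS]mulr1 -W; ring.
Qed.

(** The Wronskian with a solution of data (0, 1) or (1, 0) at y is u(y) or - p(y) there, and it
    vanishes at x. *)
Lemma edge_solution_unique0 a b v lam u p x : a <= x <= b -> L1_on a b v ->
  edge_solution a b v lam u p -> u x = 0 -> p x = 0 ->
  forall y, a <= y <= b -> u y = 0 /\ p y = 0.
Proof.
move=> xab v1 us ux px y yab; split.
  have [w [q [ws wy qy]]] := edge_solution_exists lam 0 1 yab v1.
  have := wronskian_cst us ws xab yab.
  by rewrite ux px wy qy !mul0r mulr1 mulr0 !subr0 => <-.
have [w [q [ws wy qy]]] := edge_solution_exists lam 1 0 yab v1.
have := wronskian_cst us ws xab yab.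
rewrite ux px wy qy !mul0r mulr1 mulr0 subrr sub0r => /eqP.
by rewrite eq_sym oppr_eq0 => /eqP.
Qed.

Lemma edge_solution_unique a b v lam u p w q x : a <= x <= b -> L1_on a b v ->
  edge_solution a b v lam u p -> edge_solution a b v lam w q ->
  u x = w x -> p x = q x ->
  forall y, a <= y <= b -> u y = w y /\ p y = q y.
Proof.
move=> xab v1 us ws ux px y yab.
have h := edge_solution_lin 1 (-1) us ws.
have [||e1 e2] := edge_solution_unique0 xab v1 h _ _ yab; try by rewrite ?ux ?px; ring.
by split; apply/eqP; rewrite -subr_eq0; apply/eqP; [rewrite -e1|rewrite -e2]; ring.
Qed.

Lemma L1_on_subset a b a' b' v : a <= a' -> b' <= b -> L1_on a b v -> L1_on a' b' v.
Proof.
move=> aa bb [v1 v2].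
have sub : [set` `[a', b']] `<=` [set` `[a, b]].
  move=> t /=; rewrite !in_itv/= => /andP[a't tb'].
  by rewrite (le_trans aa)//= (le_trans tb').
by split; [apply: integrableS v1|apply: integrableS v2].
Qed.

End Existence.

(** * Determinants *)

Section Determinants.
Variable F : fieldType.

(** Multiplying on the left by a block triangular matrix of determinant det d clears the upper right
    block, since diagonal matrices commute; det d is then cancelled. An integral domain is allowed
    so that polynomial entries can be used. *)
Let det_block_diag_unit (K : idomainType) n (A C : 'M[K]_n) (b d : 'rV[K]_n) :
  \det (diag_mx d) != 0 ->
  \det (block_mx A (diag_mx b) C (diag_mx d)) =
  \det (diag_mx d *m A - diag_mx b *m C).
Proof.
move=> d0.
have e : block_mx (diag_mx d) (- diag_mx b) 0 1%:M *m
    block_mx A (diag_mx b) C (diag_mx d) =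
    block_mx (diag_mx d *m A - diag_mx b *m C) 0 C (diag_mx d).
  rewrite mulmx_block !mul0mx !mul1mx !add0r !mulNmx; congr block_mx.
  by rewrite diag_mxC subrr.
have := congr1 determinant e.
rewrite det_mulmx det_ublock det_lblock det1 mulr1 mulrC.
exact: (mulIf d0).
Qed.

(* Perturbing [d] to [d + 'X] makes the lower right block invertible. *)
Lemma det_block_diag n (A C : 'M[F]_n) (b d : 'rV[F]_n) :
  \det (block_mx A (diag_mx b) C (diag_mx d)) =
  \det (diag_mx d *m A - diag_mx b *m C).
Proof.
pose P (m1 m2 : nat) (B : 'M[F]_(m1, m2)) := map_mx (@polyC F) B.
pose d' : 'rV[{poly F}]_n := \row_k ('X + (d 0 k)%:P).
have d0 : \det (diag_mx d') != 0.
  rewrite det_diag; apply/prodf_neq0 => k _; rewrite mxE.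
  by rewrite -size_poly_eq0 size_XaddC.
pose ev : {rmorphism {poly F} -> F} := horner_eval (0 : F).
have evP m1 m2 (B : 'M[F]_(m1, m2)) : map_mx ev (P _ _ B) = B.
  by apply/matrixP => k l; rewrite !mxE /ev/= /horner_eval hornerC.
have evd : map_mx ev d' = d.
  by apply/rowP => k; rewrite !mxE /ev/= /horner_eval hornerD hornerX hornerC add0r.
have := congr1 ev (det_block_diag_unit (P _ _ A) (P _ _ C) (P _ _ b) d0).
rewrite -!det_map_mx map_block_mx !map_diag_mx map_mxB !map_mxM !map_diag_mx.
by rewrite !evP !evd.
Qed.

(** Sylvester's identity: both sides are the determinant of the block matrix with identity diagonal
    blocks and off-diagonal blocks [- E] and [K]. *)
Lemma det_add1_mulmx m n (E : 'M[F]_(n, m)) (K : 'M[F]_(m, n)) :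
  \det (1%:M + E *m K) = \det (1%:M + K *m E).
Proof.
have e1 : block_mx 1%:M (- E) 0 1%:M *m block_mx (1%:M + E *m K) 0 K 1%:M =
    block_mx 1%:M (- E) K 1%:M.
  rewrite mulmx_block !mul1mx !mul0mx !mulmx1 mulNmx !add0r.
  by rewrite addrK.
have e2 : block_mx 1%:M 0 K 1%:M *m block_mx 1%:M (- E) 0 (1%:M + K *m E) =
    block_mx 1%:M (- E) K 1%:M.
  rewrite mulmx_block !mul1mx !mul0mx !mulmx1 mulmxN !addr0.
  by rewrite addrC addrK.
have := congr1 determinant (etrans e1 (esym e2)).
by rewrite !det_mulmx !det_ublock !det_lblock !det1 !mul1r mulr1.
Qed.

(** [X] differs from the identity only in the rows hit by [f], so [X = 1%:M + E *m K] with [E] the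
    inclusion of these rows, and Sylvester's identity moves the determinant to the smaller size. *)
Lemma det_mxsub_id_rows m n (f : 'I_m -> 'I_n) (X : 'M[F]_n) : injective f ->
  (forall k, k \notin codom f -> forall l, X k l = (k == l)%:R) ->
  \det X = \det (mxsub f f X).
Proof.
move=> finj Xid.
pose E : 'M[F]_(n, m) := \matrix_(k, c) (k == f c)%:R.
pose K : 'M[F]_(m, n) := rowsub f (X - 1%:M).
have -> : X = 1%:M + E *m K.
  apply/matrixP => k l; rewrite !mxE.
  have [/codomP[c ->]|kf] := boolP (k \in codom f).
    rewrite (bigD1 c)//= big1 ?addr0 => [|c' c'c].
      by rewrite !mxE eqxx mul1r addrC subrK.
    by rewrite !mxE (inj_eq finj) eq_sym (negbTE c'c) mul0r.
  rewrite big1 ?addr0 ?Xid// => c _; rewrite !mxE.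
  by case: eqP kf => [->|_ _]; rewrite ?codom_f ?mul0r.
rewrite det_add1_mulmx; congr determinant.
apply/matrixP => c c'; rewrite !mxE.
rewrite (bigD1 (f c'))//= big1 ?addr0 => [|l lc]; last first.
  by rewrite !mxE (negbTE lc) mulr0.
rewrite [in RHS](bigD1 c)//= [in RHS]big1 ?addr0 => [|c1 c1c]; last first.
  by rewrite !mxE (inj_eq finj) eq_sym (negbTE c1c) mul0r.
by rewrite !mxE !eqxx mulr1 mul1r (inj_eq finj).
Qed.

End Determinants.

(** * Evans functions of star graphs *)

Section EdgeFacts.
Local Open Scope sesquilinear_scope.
Context (R : realType).
Implicit Types (a b x : R) (v u p w q : R -> R[i]) (c d lam : R[i]).

(** A nondegenerate interval has other points arbitrarily near each of its points, on one side at
    least, and these force the derivative to be 0. *)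
Lemma real_deriv_in_eq0 a b (f : R -> R) x (d : R) : a < b -> a <= x <= b ->
  (forall y, a <= y <= b -> f y = 0) -> real_deriv_in a b f x d -> d = 0.
Proof.
move=> ab /andP[ax xb] f0 /real_deriv_inP fd.
apply/eqP; rewrite -normr_le0; apply/ler_addgt0Pl => e e0; rewrite addr0.
have [r r0 fr] := fd e e0.
suff [y [yab yr yx]] : exists y, [/\ a <= y <= b, `|y - x| < r & y - x != 0].
  have := fr y yab yr; rewrite !f0 ?ax// subrr sub0r normrN normrM.
  by rewrite ler_pM2r// normr_gt0.
have [xltb|bx] := ltP x b.
  exists (Num.min b (x + r / 2)).
  have [h|h] := leP b (x + r / 2).
    by split; [rewrite (ltW ab) lexx|rewrite ger0_norm; lra|rewrite subr_eq0 gt_eqF].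
  by split; [lra|rewrite ger0_norm; lra|rewrite addrC addKr gt_eqF//; lra].
have xE : x = b by apply/eqP; rewrite eq_le xb bx.
exists (Num.max a (x - r / 2)).
have [h|h] := leP a (x - r / 2).
  by split; [lra|rewrite ltr0_norm; lra|rewrite addrC addKr lt_eqF//; lra].
split; [by rewrite lexx (ltW ab)|rewrite ltr0_norm; lra|rewrite subr_eq0 lt_eqF//; lra].
Qed.

Lemma edge_solution_eq0 a b v lam u p : a < b -> edge_solution a b v lam u p ->
  (forall x, a <= x <= b -> u x = 0) -> forall x, a <= x <= b -> p x = 0.
Proof.
move=> ab [_ ud _ _] u0 x xab; have [d1 d2] := ud x xab.
apply/eqP; rewrite eq_complex; apply/andP; split; apply/eqP.
  by apply: (real_deriv_in_eq0 ab xab _ d1) => y yab; rewrite u0.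
by apply: (real_deriv_in_eq0 ab xab _ d2) => y yab; rewrite u0.
Qed.

Lemma edge_solution_sum a b v lam (I : Type) (s : seq I) (d : I -> R[i])
    (U P : I -> R -> R[i]) :
  (forall i, edge_solution a b v lam (U i) (P i)) ->
  edge_solution a b v lam (fun x => \sum_(i <- s) d i * U i x)
    (fun x => \sum_(i <- s) d i * P i x).
Proof.
move=> sol; elim: s => [|i s ih].
  rewrite (_ : (fun x => _) = fun=> 0); last by apply/funext => x; rewrite big_nil.
  rewrite [X in edge_solution _ _ _ _ _ X](_ : _ = fun=> 0).
    exact: edge_solution0.
  by apply/funext => x; rewrite big_nil.
have := edge_solution_lin (d i) 1 (sol i) ih.
set U' := (fun x => _); set P' := (fun x => _).
rewrite (_ : U' = fun x => \sum_(j <- i :: s) d j * U j x); last first.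
  by apply/funext => x; rewrite big_cons /U' mul1r.
rewrite (_ : P' = fun x => \sum_(j <- i :: s) d j * P j x)//.
by apply/funext => x; rewrite big_cons /P' mul1r.
Qed.

(** Links the normalisation of the outer solution, with data (- conj b, conj a), to the condition a
    u + b p = 0. Multiplying by the nonzero coefficient or its conjugate turns one expression into a
    multiple of the other, since a conj(b) is real. *)
Lemma conj_pairing (a b u p : R[i]) : a * b^* = b * a^* -> (a != 0) || (b != 0) ->
  u * a^* + p * b^* = 0 <-> a * u + b * p = 0.
Proof.
move=> ab ab0; split => e; apply/eqP.
  case/orP: ab0 => [a0|b0].
    rewrite -(mulrI_eq0 _ (mulfI (_ : a^* != 0))) ?conjC_eq0//; apply/eqP.
    have -> : a^* * (a * u + b * p) = a * (u * a^*) + p * (b * a^*) by ring.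
    by rewrite -ab; transitivity (a * (u * a^* + p * b^*)); [ring|rewrite e mulr0].
  rewrite -(mulrI_eq0 _ (mulfI (_ : b^* != 0))) ?conjC_eq0//; apply/eqP.
  have -> : b^* * (a * u + b * p) = u * (a * b^*) + b * (p * b^*) by ring.
  by rewrite ab; transitivity (b * (u * a^* + p * b^*)); [ring|rewrite e mulr0].
case/orP: ab0 => [a0|b0].
  rewrite -(mulrI_eq0 _ (mulfI a0)); apply/eqP.
  have -> : a * (u * a^* + p * b^*) = a * u * a^* + p * (a * b^*) by ring.
  by rewrite ab; transitivity (a^* * (a * u + b * p)); [ring|rewrite e mulr0].
rewrite -(mulrI_eq0 _ (mulfI b0)); apply/eqP.
have -> : b * (u * a^* + p * b^*) = u * (b * a^*) + b * p * b^* by ring.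
by rewrite -ab; transitivity (b^* * (a * u + b * p)); [ring|rewrite e mulr0].
Qed.

End EdgeFacts.

(** * Evans functions as determinants of Wronskians *)

Section Graph.
Local Open Scope sesquilinear_scope.
Context (R : realType) (n : nat).
Implicit Types (Om : star_graph R n) (G : bound_cond R n) (lam : R[i]).
Implicit Types (u p z : 'I_n -> R -> R[i]) (Y : 'I_n -> 'I_n -> R -> R[i]).
Implicit Types (g h : 'rV[R[i]]_n).

Definition regular_graph Om := forall k, org Om k < out Om k /\
  L1_on (org Om k) (out Om k) (pot Om k).

Definition regular_cond G g h :=
  [/\ beta1 G = diag_mx g, beta2 G = diag_mx h,
      alpha1 G *m (alpha2 G)^t* = alpha2 G *m (alpha1 G)^t*,
      row_free (row_mx (alpha1 G) (alpha2 G)) &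
      forall k, g 0 k * (h 0 k)^* = h 0 k * (g 0 k)^* /\
        (g 0 k != 0) || (h 0 k != 0)].

Lemma outer_cond_diag Om G g h u p :
  beta1 G = diag_mx g -> beta2 G = diag_mx h ->
  outer_cond Om G u p <->
  forall k, g 0 k * u k (out Om k) + h 0 k * p k (out Om k) = 0.
Proof.
rewrite /outer_cond => -> ->; rewrite !mul_diag_mx; split.
  by move=> /matrixP e k; have := e k 0; rewrite !mxE.
by move=> e; apply/matrixP => k c; rewrite !mxE e.
Qed.

(** The injectivity clause of the resolvent set, with f = 0, compares u with the zero function; it
    controls only u, and p follows by differentiation. *)
Lemma bvp_trivial Om G lam u p : regular_graph Om -> resolvent_set Om G lam ->
  solution Om lam u p -> origin_cond Om G u p -> outer_cond Om G u p ->
  forall k x, on_edge Om k x -> u k x = 0 /\ p k x = 0.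
Proof.
move=> regOm [_ inj _] sol uorg uout k.
have lamE w : (fun (k : 'I_n) (x : R) => 0 + lam * w k x) = (fun k x => lam * w k x).
  by apply/funext => l; apply/funext => x; rewrite add0r.
have L2w w q : solution Om lam w q -> L2 Om (fun k x => lam * w k x).
  move=> ws l; apply: abs_cont_L2; apply: abs_contM; first exact: abs_cont_cst.
  by have [] := ws l.
have sol0 : solution Om lam (fun _ _ => 0) (fun _ _ => 0).
  by move=> l; exact: edge_solution0.
have u0 x : on_edge Om k x -> u k x = 0.
  apply: (inj (fun _ _ => 0) u (fun _ _ => 0)); rewrite lamE.
    by split; [exact: L2w sol|exists p].
  split; first exact: L2w sol0.
  exists (fun _ _ => 0); split => //; rewrite /origin_cond /outer_cond.
    rewrite (_ : \col_k 0 = 0) ?mulmx0 ?addr0//.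
    by apply/matrixP => ? ?; rewrite !mxE.
  rewrite (_ : \col_k 0 = 0) ?mulmx0 ?addr0//.
  by apply/matrixP => ? ?; rewrite !mxE.
move=> x xk; split; first exact: u0.
exact: (edge_solution_eq0 (regOm k).1 (sol k) u0).
Qed.

Definition origin_system Om G lam Y (Y' : 'I_n -> 'I_n -> R -> R[i]) :=
  [/\ forall c, solution Om lam (Y^~ c) (Y'^~ c),
      mx_at Y (org Om) = - (alpha2 G)^t* & mx_at Y' (org Om) = (alpha1 G)^t*].

(** Only the diagonal of Z is kept: for a diagonal outer condition the other entries have zero
    Cauchy data at the outer endpoints. z k is zeta_k of the overview. *)
Definition outer_system Om g h lam z (z' : 'I_n -> R -> R[i]) :=
  [/\ solution Om lam z z', forall k, z k (out Om k) = - (h 0 k)^* &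
      forall k, z' k (out Om k) = (g 0 k)^*].

Definition wronskian_mx Y (Y' : 'I_n -> 'I_n -> R -> R[i]) z
    (z' : 'I_n -> R -> R[i]) (x : 'I_n -> R) : 'M[R[i]]_n :=
  \matrix_(k, c) (Y k c (x k) * z' k (x k) - Y' k c (x k) * z k (x k)).

Lemma org_on_edge Om : regular_graph Om -> forall k, on_edge Om k (org Om k).
Proof. by move=> reg k; rewrite /on_edge lexx (ltW (reg k).1). Qed.

Lemma out_on_edge Om : regular_graph Om -> forall k, on_edge Om k (out Om k).
Proof. by move=> reg k; rewrite /on_edge lexx (ltW (reg k).1). Qed.

Lemma origin_system_exists Om G lam : regular_graph Om ->
  exists Y Y', origin_system Om G lam Y Y'.
Proof.
move=> reg.
have ex (kc : 'I_n * 'I_n) : exists up : (R -> R[i]) * (R -> R[i]),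
    [/\ edge_solution (org Om kc.1) (out Om kc.1) (pot Om kc.1) lam up.1 up.2,
     up.1 (org Om kc.1) = (- (alpha2 G)^t*) kc.1 kc.2 &
     up.2 (org Om kc.1) = ((alpha1 G)^t*) kc.1 kc.2].
  have [u [p ?]] := edge_solution_exists lam ((- (alpha2 G)^t*) kc.1 kc.2)
    (((alpha1 G)^t*) kc.1 kc.2) (org_on_edge reg kc.1) (reg kc.1).2.
  by exists (u, p).
have [Y hY] := choice ex.
exists (fun k c => (Y (k, c)).1), (fun k c => (Y (k, c)).2); split.
- by move=> c k; have [] := hY (k, c).
- by apply/matrixP => k c; rewrite mxE; have [_ -> _] := hY (k, c).
- by apply/matrixP => k c; rewrite mxE; have [_ _ ->] := hY (k, c).
Qed.

Lemma outer_system_exists Om g h lam : regular_graph Om ->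
  exists z z', outer_system Om g h lam z z'.
Proof.
move=> reg.
have ex k : exists up : (R -> R[i]) * (R -> R[i]),
    [/\ edge_solution (org Om k) (out Om k) (pot Om k) lam up.1 up.2,
     up.1 (out Om k) = - (h 0 k)^* & up.2 (out Om k) = (g 0 k)^*].
  have [u [p ?]] := edge_solution_exists lam (- (h 0 k)^*) ((g 0 k)^*)
    (out_on_edge reg k) (reg k).2.
  by exists (u, p).
have [z hz] := choice ex.
by exists (fun k => (z k).1), (fun k => (z k).2); split => k; have [] := hz k.
Qed.

Lemma wronskian_mx_cst Om G g h lam Y Y' z z' x y :
  origin_system Om G lam Y Y' -> outer_system Om g h lam z z' ->
  (forall k, on_edge Om k (x k)) -> (forall k, on_edge Om k (y k)) ->
  wronskian_mx Y Y' z z' x = wronskian_mx Y Y' z z' y.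
Proof.
move=> [Ysol _ _] [zsol _ _] xe ye; apply/matrixP => k c; rewrite !mxE.
exact: (wronskian_cst (Ysol c k) (zsol k) (xe k) (ye k)).
Qed.

Let det_wronskian Y (Y' : 'I_n -> 'I_n -> R -> R[i]) z (z' : 'I_n -> R -> R[i])
    (x : 'I_n -> R) :
  \det (block_mx (mx_at Y x) (diag_mx (\row_k z k (x k)))
                 (mx_at Y' x) (diag_mx (\row_k z' k (x k)))) =
  \det (wronskian_mx Y Y' z z' x).
Proof.
rewrite det_block_diag !mul_diag_mx; congr determinant.
by apply/matrixP => k c; rewrite !mxE [in RHS]mulrC [Y' _ _ _ * _]mulrC.
Qed.

(** Shows that [is_evans] holds of exactly one number, so that the default value in [evans] does not
    intervene. *)
Lemma evansE Om G g h lam Y Y' z z' x : regular_graph Om ->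
  beta1 G = diag_mx g -> beta2 G = diag_mx h ->
  origin_system Om G lam Y Y' -> outer_system Om g h lam z z' ->
  (forall k, on_edge Om k (x k)) ->
  evans Om G lam = \det (wronskian_mx Y Y' z z' x).
Proof.
move=> reg b1 b2 Ysys zsys xe.
have [Ysol Y0 Y'0] := Ysys; have [zsol z0 z'0] := zsys.
have diagT (d : 'rV[R[i]]_n) (k c : 'I_n) :
    ((diag_mx d)^t*) k c = if k == c then (d 0 c)^* else 0.
  by rewrite !mxE; case: (eqVneq k c) => _; rewrite ?mulr1n ?mulr0n ?conjC0.
apply: xget_unique.
  exists Y, Y', (fun k c => if k == c then z k else fun=> 0),
    (fun k c => if k == c then z' k else fun=> 0); split => //.
  - move=> c k /=; case: eqP => _; [exact: zsol|exact: edge_solution0].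
  - split; apply/matrixP => k c; rewrite ?b2 ?b1.
      rewrite [LHS]mxE [RHS]mxE diagT.
      by case: eqP => [<-|_]; [exact: z0|rewrite oppr0].
    by rewrite [LHS]mxE diagT; case: eqP => [<-|_] //; exact: z'0.
  - move=> x' xe'; rewrite (wronskian_mx_cst Ysys zsys xe xe') -det_wronskian.
    congr (\det (block_mx _ _ _ _)); apply/matrixP => k c; rewrite !mxE;
    by case: eqP => [->|_]; rewrite ?mulr1n ?mulr0n.
(* Any other choice of fundamental matrices is compared at the origin: Y is prescribed there, and Z
   is transported from the outer endpoints by uniqueness. *)
move=> E [Y1 [Y1' [Z1 [Z1' [_ Zsol [Y10 Y1'0] [Z10 Z1'0] /(_ _ (org_on_edge reg)) ->]]]]].
rewrite (wronskian_mx_cst Ysys zsys xe (org_on_edge reg)) -det_wronskian.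
have Z1E k c : Z1 k c (org Om k) = (if k == c then z k (org Om k) else 0) /\
    Z1' k c (org Om k) = (if k == c then z' k (org Om k) else 0).
  have : Z1 k c (out Om k) = (if k == c then z k (out Om k) else 0) /\
      Z1' k c (out Om k) = (if k == c then z' k (out Om k) else 0).
    move: Z10 Z1'0 => /matrixP/(_ k c) + /matrixP/(_ k c).
    rewrite mxE [RHS]mxE b2 diagT => ->; rewrite mxE b1 diagT => ->.
    by rewrite z0 z'0; case: eqP => [->|_]; rewrite ?oppr0.
  case: eqP => [_|_] [e1 e2].
    exact: (edge_solution_unique (out_on_edge reg k) (reg k).2
      (Zsol c k) (zsol k) e1 e2 (org_on_edge reg k)).
  exact: (edge_solution_unique0 (out_on_edge reg k) (reg k).2
    (Zsol c k) e1 e2 (org_on_edge reg k)).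
rewrite Y10 Y1'0 -Y0 -Y'0.
congr (\det (block_mx _ _ _ _)); apply/matrixP => k c; rewrite !mxE;
rewrite ((Z1E k c).1, (Z1E k c).2); by case: eqP => [->|_]; rewrite ?mulr1n ?mulr0n.
Qed.

(** Row k of the Wronskian matrix applied to [d] is u conj(g_k) + p conj(h_k) for the combination u
    of the columns of Y, and [conj_pairing] converts its vanishing. *)
Lemma outer_cond_wronskian Om G g h lam Y Y' z z' (d : 'cV[R[i]]_n) k :
  regular_cond G g h -> outer_system Om g h lam z z' ->
  (wronskian_mx Y Y' z z' (out Om) *m d) k 0 = 0 ->
  g 0 k * (\sum_c d c 0 * Y k c (out Om k)) +
  h 0 k * (\sum_c d c 0 * Y' k c (out Om k)) = 0.
Proof.
move=> [_ _ _ _ gh] [_ z0 z'0]; set u := \sum_c _; set p := \sum_c _.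
have -> : (wronskian_mx Y Y' z z' (out Om) *m d) k 0 =
    u * (g 0 k)^* + p * (h 0 k)^*.
  rewrite mxE.
  rewrite !mulr_suml -big_split/=; apply: eq_bigr => c _.
  by rewrite mxE z0 z'0; ring.
move=> e; have [ghE gh0] := gh k.
exact: (proj1 (conj_pairing u p ghE gh0) e).
Qed.

Lemma origin_cond_comb Om G lam Y Y' (d : 'cV[R[i]]_n) :
  alpha1 G *m (alpha2 G)^t* = alpha2 G *m (alpha1 G)^t* ->
  origin_system Om G lam Y Y' ->
  origin_cond Om G (fun k x => \sum_c d c 0 * Y k c x)
    (fun k x => \sum_c d c 0 * Y' k c x).
Proof.
move=> sa [_ Y0 Y'0]; rewrite /origin_cond.
have col (Z : 'I_n -> 'I_n -> R -> R[i]) :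
    \col_k (\sum_c d c 0 * Z k c (org Om k)) = mx_at Z (org Om) *m d.
  apply/matrixP => k l; rewrite !mxE; apply: eq_bigr => c _.
  by rewrite !mxE ord1 mulrC.
by rewrite !col Y0 Y'0 mulNmx mulmxN !mulmxA sa addNr.
Qed.

Lemma comb_solution Om G lam Y Y' (d : 'cV[R[i]]_n) :
  origin_system Om G lam Y Y' ->
  solution Om lam (fun k x => \sum_c d c 0 * Y k c x)
    (fun k x => \sum_c d c 0 * Y' k c x).
Proof.
move=> [Ysol _ _] k; apply: edge_solution_sum => c; exact: Ysol.
Qed.

(** A kernel vector combines the columns of Y into a solution of the homogeneous boundary value
    problem, which is zero on the resolvent set. Its data at the origin then contradict the rank of
    [row_mx (alpha1 G) (alpha2 G)]. *)
Lemma evans_neq0 Om G g h lam Y Y' z z' : regular_graph Om ->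
  regular_cond G g h -> resolvent_set Om G lam ->
  origin_system Om G lam Y Y' -> outer_system Om g h lam z z' ->
  \det (wronskian_mx Y Y' z z' (out Om)) != 0.
Proof.
move=> reg creg res Ysys zsys; rewrite -det_tr; apply/negP => /det0P[e e0 eW].
have We : wronskian_mx Y Y' z z' (out Om) *m e^T = 0.
  by rewrite -[LHS]trmxK trmx_mul trmxK eW trmx0.
have [b1 b2 sa free gh] := creg.
have triv := bvp_trivial reg res (comb_solution e^T Ysys)
  (origin_cond_comb e^T sa Ysys).
have {}triv : forall k x, on_edge Om k x ->
    \sum_c e^T c 0 * Y k c x = 0 /\ \sum_c e^T c 0 * Y' k c x = 0.
  apply: triv; apply/(outer_cond_diag _ _ _ b1 b2) => k.
  by apply: (outer_cond_wronskian creg zsys); rewrite We mxE.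
have [_ Y0 Y'0] := Ysys.
(* After conjugation, vanishing data at the origin say that the conjugate of [e] multiplies alpha1
   and alpha2 to zero. *)
have alpha0 (A : 'M[R[i]]_n) (Z : 'I_n -> 'I_n -> R -> R[i]) :
    mx_at Z (org Om) = A^t* -> (forall k, \sum_c e^T c 0 * Z k c (org Om k) = 0) ->
    map_mx Num.conj e *m A = 0.
  move=> ZA Ze; apply/matrixP => l k; rewrite !mxE ord1.
  transitivity ((\sum_c e^T c 0 * Z k c (org Om k))^*); last by rewrite Ze conjC0.
  rewrite rmorph_sum; apply: eq_bigr => c _; rewrite rmorphM/=.
  move/matrixP/(_ k c): ZA; rewrite !mxE => ->.
  by rewrite conjCK.
have a1 : map_mx Num.conj e *m alpha1 G = 0.
  by apply: (alpha0 _ Y') => // k; exact: (triv k _ (org_on_edge reg k)).2.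
have a2 : map_mx Num.conj e *m alpha2 G = 0.
  apply: (alpha0 _ (fun k c x => - Y k c x)).
    apply/matrixP => k c; move/matrixP/(_ k c): Y0; rewrite !mxE => ->.
    by rewrite opprK.
  move=> k; transitivity (- \sum_c e^T c 0 * Y k c (org Om k)); last first.
    by rewrite (triv k _ (org_on_edge reg k)).1 oppr0.
  by rewrite -sumrN; apply: eq_bigr => c _; rewrite mulrN.
have : map_mx Num.conj e *m row_mx (alpha1 G) (alpha2 G) = 0.
  by rewrite mul_mx_row a1 a2 row_mx0.
move=> /eqP; rewrite mulmx_free_eq0// => /eqP ce0.
move/negP: e0; apply; apply/eqP/matrixP => l k.
move/matrixP/(_ l k): ce0; rewrite !mxE => /eqP.
by rewrite conjC_eq0 => /eqP.
Qed.

End Graph.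

(** * The pieces of the splitting *)

Section Interval.
Local Open Scope sesquilinear_scope.
Context (R : realType) (a b : R) (v : R -> R[i]) (lam b1 b2 : R[i]).
Context (ab : a < b) (v1 : L1_on a b v).
Context (b12 : b1 * b2^* = b2 * b1^*) (b0 : (b1 != 0) || (b2 != 0)).

Let Om : star_graph R 1 := interval_graph a b v.
Let G : bound_cond R 1 := interval_cond 1 0 b1 b2.

Lemma regular_interval : regular_graph Om. Proof. by move=> k. Qed.

Lemma regular_interval_cond : regular_cond G (const_mx b1) (const_mx b2).
Proof.
have M0 : 0%:M = 0 :> 'M[R[i]]_1 by exact: raddf0.
split; rewrite /= ?M0 ?diag_const_mx//.
- by rewrite trmx0 map_mx0 mulmx0 mul0mx.
- apply/row_freeP; exists (col_mx 1%:M 0).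
  by rewrite mul_row_col mulmx1 mulmx0 addr0.
- by move=> k; rewrite !mxE.
Qed.

Context (z z' : R -> R[i]).
Context (zsol : edge_solution a b v lam z z') (zb : z b = - b2^*) (z'b : z' b = b1^*).

Let zsys : outer_system Om (const_mx b1) (const_mx b2) lam (fun=> z) (fun=> z').
Proof. by split => [k|k|k] //=; rewrite mxE. Qed.

(** The Dirichlet condition gives Y the data (0, 1) at a, so only the term - Y' z survives there. *)
Let det_wronskian Y Y' : origin_system Om G lam Y Y' ->
  \det (wronskian_mx Y Y' (fun=> z) (fun=> z') (org Om)) = - z a.
Proof.
move=> [_ Y0 Y'0]; rewrite det_mx11 !mxE /=.
move/matrixP/(_ 0 0): Y0; rewrite !mxE /= => ->.
move/matrixP/(_ 0 0): Y'0; rewrite !mxE /= => ->.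
by rewrite mul0rn conjC0 oppr0 mul0r mulr1n conjC1 mul1r sub0r.
Qed.

Lemma evans_interval : evans Om G lam = - z a.
Proof.
have [Y [Y' Ysys]] := origin_system_exists G lam regular_interval.
have [B1 B2 _ _ _] := regular_interval_cond.
rewrite (evansE regular_interval B1 B2 Ysys zsys (org_on_edge regular_interval)).
exact: det_wronskian Ysys.
Qed.

Context (res : resolvent_set Om G lam).

Lemma interval_left_neq0 : z a != 0.
Proof.
have [Y [Y' Ysys]] := origin_system_exists G lam regular_interval.
have := evans_neq0 regular_interval regular_interval_cond res Ysys zsys.
rewrite (wronskian_mx_cst Ysys zsys (out_on_edge regular_interval)
  (org_on_edge regular_interval)) det_wronskian//.
by rewrite oppr_eq0.
Qed.

Lemma interval_dtn_exists c : exists u p : 'I_1 -> R -> R[i],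
  [/\ solution Om lam u p, u 0 a = c, outer_cond Om G u p & p 0 a = z' a / z a * c].
Proof.
exists (fun _ x => c / z a * z x + 0 * z x), (fun _ x => c / z a * z' x + 0 * z' x).
split.
- by move=> k; exact: edge_solution_lin.
- by rewrite mul0r addr0 divfK// interval_left_neq0.
- have [B1 B2 _ _ _] := regular_interval_cond.
  apply/(outer_cond_diag _ _ _ B1 B2) => k; rewrite !mxE /= zb z'b !mul0r !addr0.
  have -> : b1 * (c / z a * - b2^*) + b2 * (c / z a * b1^*) =
    c / z a * (b2 * b1^* - b1 * b2^*) by ring.
  by rewrite b12 subrr mulr0.
- by rewrite mul0r addr0; ring.
Qed.

(** By the outer condition the Wronskian of u and z vanishes at b, hence at a, so u and z have the
    same logarithmic derivative at a. *)
Lemma interval_dtn_unique (u p : 'I_1 -> R -> R[i]) :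
  solution Om lam u p -> outer_cond Om G u p -> p 0 a = z' a / z a * u 0 a.
Proof.
move=> usol; have [B1 B2 _ _ _] := regular_interval_cond.
move/(outer_cond_diag _ _ _ B1 B2) => /(_ 0); rewrite !mxE /=.
move/(conj_pairing _ _ b12 b0) => e.
have aab : a <= a <= b by rewrite lexx ltW.
have bab : a <= b <= b by rewrite lexx ltW.
have := wronskian_cst (usol 0) zsol aab bab.
rewrite zb z'b mulrN opprK e => /eqP; rewrite subr_eq0 => /eqP W.
by rewrite mulrAC [z' a * _]mulrC W mulfK// interval_left_neq0.
Qed.

End Interval.

(** * The star with shortened edges and its Dirichlet-to-Neumann matrix *)

Section ShortenedStar.
Local Open Scope sesquilinear_scope.
Context (R : realType) (n : nat) (ell : 'I_n -> R) (V : 'I_n -> R -> R[i]).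
Context (G : bound_cond R n) (g h : 'rV[R[i]]_n) (i j : 'I_n) (s1 s2 : R) (lam : R[i]).
Context (hell : forall k, 0 < ell k) (hV : forall k, L1_on 0 (ell k) (V k)).
Context (regG : regular_cond G g h).
Context (hout : forall k, 0 < out (tpiece2 ell V i j s1 s2) k <= ell k).

Let Om := star ell V.
Let Om2 := tpiece2 ell V i j s1 s2.
Let G2 := tcond2 G i j.
Let short := shortened i j.
Let g2 : 'rV[R[i]]_n := \row_k if short k then 1 else g 0 k.
Let h2 : 'rV[R[i]]_n := \row_k if short k then 0 else h 0 k.

Lemma regular_star : regular_graph Om. Proof. by move=> k. Qed.

Lemma regular_shortened : regular_graph Om2.
Proof.
move=> k; have /andP[k0 kl] := hout k; split => //.
exact: L1_on_subset (lexx 0) kl (hV k).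
Qed.

Lemma regular_shortened_cond : regular_cond G2 g2 h2.
Proof.
have [b1 b2 sa free gh] := regG; split => //=.
- congr diag_mx; apply/rowP => k; rewrite !mxE b1 !mxE eqxx mulr1n.
  by case: ifP.
- congr diag_mx; apply/rowP => k; rewrite !mxE b2 !mxE eqxx mulr1n.
  by case: ifP.
- move=> k; rewrite !mxE; case: ifP => _; last exact: gh.
  by rewrite conjC0 mulr0 mul0r oner_eq0.
Qed.

Context (Y Y' : 'I_n -> 'I_n -> R -> R[i]) (Ysys : origin_system Om G lam Y Y').

(** Shortening leaves the origin and its condition untouched, so the same Y serves both stars; this
    makes their Evans functions comparable. *)
Lemma origin_system_shortened : origin_system Om2 G2 lam Y Y'.
Proof.
have [Ysol Y0 Y'0] := Ysys; split => // c k.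
have /andP[_ kl] := hout k.
exact: (edge_solution_subset (lexx 0) kl (Ysol c k)).
Qed.

Context (y y' : 'I_n -> R -> R[i]) (ysys : outer_system Om2 g2 h2 lam y y').

Definition shortened_mx := wronskian_mx Y Y' y y' (out Om2).

Lemma evans_shortened : evans Om2 G2 lam = \det shortened_mx.
Proof.
have [b1 b2 _ _ _] := regular_shortened_cond.
exact: (evansE regular_shortened b1 b2 origin_system_shortened ysys
  (out_on_edge regular_shortened)).
Qed.

Context (res : resolvent_set Om2 G2 lam).

Lemma shortened_mx_unit : shortened_mx \in unitmx.
Proof.
rewrite unitmxE unitfE.
exact: (evans_neq0 regular_shortened regular_shortened_cond res
  origin_system_shortened ysys).
Qed.

(* Dirichlet-to-Neumann matrix of the shortened star; only the rows and columns
   of the shortened edges are meaningful. *)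
Definition dtn_mx : 'M[R[i]]_n := mx_at Y' (out Om2) *m invmx shortened_mx.

(** The solution is the combination of the columns of Y with coefficients B~^-1 f: the rows of B~ on
    shortened edges give the Dirichlet data, and the zero entries of f give the outer conditions on
    the other edges. *)
Lemma shortened_dtn_exists (f : 'cV[R[i]]_n) : (forall k, ~~ short k -> f k 0 = 0) ->
  exists w p, [/\ tpiece2_problem ell V G i j s1 s2 lam w p,
    forall k, short k -> w k (out Om2 k) = f k 0 &
    forall k, p k (out Om2 k) = (dtn_mx *m f) k 0].
Proof.
move=> f0; pose d := invmx shortened_mx *m f.
have Bd : shortened_mx *m d = f by rewrite mulKVmx// shortened_mx_unit.
have [b1 b2 sa _ _] := regular_shortened_cond.
exists (fun k x => \sum_c d c 0 * Y k c x), (fun k x => \sum_c d c 0 * Y' k c x).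
have [_ y0 y'0] := ysys.
split; first split.
- exact: comb_solution origin_system_shortened.
- exact: (origin_cond_comb d sa origin_system_shortened).
- move=> k sk; rewrite -[tcond2 G i j]/G2 b1 b2.
  have Bdk : (shortened_mx *m d) k 0 = 0 by rewrite Bd f0.
  have := outer_cond_wronskian regular_shortened_cond ysys Bdk.
  by rewrite ![diag_mx _ _ _]mxE eqxx !mulr1n.
- move=> k sk; rewrite -Bd mxE; apply: eq_bigr => c _.
  rewrite [shortened_mx _ _]mxE y0 y'0 ![(\row_k _) _ _]mxE sk.
  by rewrite conjC1 conjC0 oppr0 mulr0 subr0 mulr1 mulrC.
- move=> k; rewrite /dtn_mx -mulmxA -/d mxE; apply: eq_bigr => c _.
  by rewrite [mx_at _ _ _ _]mxE mulrC.
Qed.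

Lemma shortened_dtn_unique w p w' p' :
  tpiece2_problem ell V G i j s1 s2 lam w p ->
  tpiece2_problem ell V G i j s1 s2 lam w' p' ->
  (forall k, short k -> w k (out Om2 k) = w' k (out Om2 k)) ->
  forall k, p k (out Om2 k) = p' k (out Om2 k).
Proof.
move=> [wsol worg wout] [w'sol w'org w'out] ww' k.
have [b1 b2 _ _ _] := regular_shortened_cond.
have dsol : solution Om2 lam (fun k x => 1 * w k x + (-1) * w' k x)
    (fun k x => 1 * p k x + (-1) * p' k x).
  by move=> l; exact: edge_solution_lin.
have dorg : origin_cond Om2 G2 (fun k x => 1 * w k x + (-1) * w' k x)
    (fun k x => 1 * p k x + (-1) * p' k x).
  have col (u u' : 'I_n -> R -> R[i]) :
      \col_k (1 * u k (org Om2 k) + -1 * u' k (org Om2 k)) =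
      \col_k u k (org Om2 k) - \col_k u' k (org Om2 k).
    by apply/matrixP => l m; rewrite !mxE mul1r mulN1r.
  rewrite /origin_cond !col !mulmxBr addrACA -opprD.
  by move: worg w'org; rewrite /origin_cond => -> ->; rewrite subrr.
have dout : outer_cond Om2 G2 (fun k x => 1 * w k x + (-1) * w' k x)
    (fun k x => 1 * p k x + (-1) * p' k x).
  apply/(outer_cond_diag _ _ _ b1 b2) => l.
  have [sl|sl] := boolP (short l).
    by rewrite !mxE sl ww'//; ring.
  have := wout l sl; have := w'out l sl; rewrite -[tcond2 G i j]/G2 b1 b2.
  rewrite ![diag_mx _ _ _]mxE eqxx !mulr1n => e' e.
  rewrite -[RHS](subrr 0) -{1}e -e'; ring.
have [_] := bvp_trivial regular_shortened res dsol dorg dout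
  (out_on_edge regular_shortened k).
by rewrite mul1r mulN1r => /eqP; rewrite subr_eq0 => /eqP.
Qed.

Context (z z' : 'I_n -> R -> R[i]) (zsys : outer_system Om g h lam z z').

Definition splitting_mx : 'M[R[i]]_n :=
  diag_mx (\row_k if short k then z' k (out Om2 k) else 1) -
  diag_mx (\row_k if short k then z k (out Om2 k) else 0) *m dtn_mx.

(** On a shortened edge the Wronskian row at the splitting point is z' Y - z Y', where Y is the row
    of B~ and Y' that of T B~. On the other edges the rows of B and B~ coincide. *)
Lemma evans_split : evans Om G lam = \det splitting_mx * evans Om2 G2 lam.
Proof.
have [b1 b2 _ _ _] := regG.
have out_on k : on_edge Om k (out Om2 k).
  by have /andP[k0 kl] := hout k; rewrite /on_edge/= (ltW k0).
rewrite (evansE regular_star b1 b2 Ysys zsys out_on) evans_shortened -det_mulmx.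
congr determinant; rewrite mulmxBl -mulmxA mulmxKV ?shortened_mx_unit//.
rewrite !mul_diag_mx; apply/matrixP => k c; rewrite !mxE.
have [_ y0 y'0] := ysys; rewrite y0 y'0 !mxE.
have [sk|sk] := boolP (short k).
  by rewrite conjC1 conjC0; ring.
rewrite mul1r mul0r subr0.
have -> : out Om2 k = ell k.
  by move: sk; rewrite /short /shortened negb_or /= => /andP[/negbTE -> /negbTE ->].
by have [_ z0 z'0] := zsys; rewrite z0 z'0.
Qed.

Lemma det_splitting_mx m (f : 'I_m -> 'I_n) : injective f ->
  (forall k, k \notin codom f -> ~~ short k) ->
  \det splitting_mx = \det (mxsub f f splitting_mx).
Proof.
move=> finj fs; apply: det_mxsub_id_rows => // k /fs sk l.
by rewrite mxE [X in _ + X]mxE mul_diag_mx !mxE (negbTE sk) mul0r subr0.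
Qed.

End ShortenedStar.

(** * Matrices of size two and maps given by their graphs *)

Section TwoByTwo.
Local Open Scope sesquilinear_scope.
Context (R : realType).
Implicit Types (a b c d x y : R[i]) (f : 'cV[R[i]]_2).

Definition mx2 a b c d : 'M[R[i]]_2 :=
  \matrix_(k, l) if k == 0 then (if l == 0 then a else b)
                 else (if l == 0 then c else d).

Lemma mx2_mul a b c d f : mx2 a b c d *m f =
  pair_col (a * f 0 0 + b * f 1 0) (c * f 0 0 + d * f 1 0).
Proof.
apply/matrixP => k l; rewrite !mxE ord1 big_ord_recl big_ord1.
have -> : lift ord0 ord0 = 1 :> 'I_2 by exact: val_inj.
by rewrite !mxE /=; case: ifP.
Qed.

Lemma mx2D a b c d a' b' c' d' :
  mx2 a b c d + mx2 a' b' c' d' = mx2 (a + a') (b + b') (c + c') (d + d').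
Proof. by apply/matrixP => k l; rewrite !mxE; case: ifP => _; case: ifP. Qed.

Lemma det_mx2 a b c d : \det (mx2 a b c d) = a * d - b * c.
Proof.
rewrite (expand_det_row _ 0) big_ord_recl big_ord1 /cofactor !det_mx11 !mxE /=.
by rewrite expr0 expr1 mul1r mulN1r mulrN.
Qed.

(** Solvability of the boundary value problems supplies the first hypothesis and uniqueness the
    second; the columns are compared on the basis vectors. *)
Lemma matrix_ofE (T : 'cV[R[i]]_2 -> 'cV[R[i]]_2 -> Prop) M :
  (forall f, T f (M *m f)) -> (forall f f1 f2 : 'cV[R[i]]_2, T f f1 -> T f f2 -> f1 = f2) ->
  matrix_of T = M.
Proof.
move=> TM Tfun; apply: xget_unique => // N TN.
apply/matrixP => k l; have := Tfun _ _ _ (TN (delta_mx l 0)) (TM (delta_mx l 0)).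
by rewrite -!colE => /matrixP/(_ k 0); rewrite !mxE.
Qed.

End TwoByTwo.

Lemma selfadjoint_regular (R : realType) n (G : bound_cond R n) (g h : 'rV[R[i]]_n) :
  selfadjoint_cond G -> beta1 G = diag_mx g -> beta2 G = diag_mx h ->
  regular_cond G g h.
Proof.
move=> [r1 r2 sa1 sa2] b1 b2; split => //; first by rewrite /row_free r1.
move=> k; split.
  move/matrixP/(_ k k): sa2; rewrite b1 b2 !mul_diag_mx !mxE eqxx !mulr1n.
  by [].
(* If both entries vanished, row k of [row_mx (beta1 G) (beta2 G)] would be zero, against its right
   inverse [B]. *)
rewrite -negb_and; apply/negP => /andP[/eqP gk /eqP hk].
have /row_freeP[B] : row_free (row_mx (beta1 G) (beta2 G)) by rewrite /row_free r2.
move/matrixP/(_ k k); rewrite !mxE eqxx big1 => [/esym/eqP|l _]; first by rewrite oner_eq0.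
rewrite mxE; case: (fintype.split l) => l'; rewrite ?b1 ?b2 mxE.
  by case: eqP => [_|_]; rewrite ?mulr1n ?mulr0n ?gk ?mul0r.
by case: eqP => [_|_]; rewrite ?mulr1n ?mulr0n ?hk ?mul0r.
Qed.

(** * Comparison with the two-sided map *)

Section Splitting.
Local Open Scope sesquilinear_scope.
Context (R : realType) (n : nat) (ell : 'I_n -> R) (V : 'I_n -> R -> R[i]).
Context (G : bound_cond R n) (g h : 'rV[R[i]]_n) (lam : R[i]).
Context (hell : forall k, 0 < ell k) (hV : forall k, L1_on 0 (ell k) (V k)).
Context (regG : regular_cond G g h).

Let diag_entry (d : 'rV[R[i]]_n) k : diag_mx d k k = d 0 k.
Proof. by rewrite mxE eqxx mulr1n. Qed.

Let cond1E j : cond1 G j = interval_cond 1 0 (g 0 j) (h 0 j).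
Proof. by have [b1 b2 _ _ _] := regG; rewrite /cond1 b1 b2 !diag_entry. Qed.

Context (z z' : 'I_n -> R -> R[i]) (zsys : outer_system (star ell V) g h lam z z').

Let z_end k : z k (ell k) = - (h 0 k)^*. Proof. by have [_ ->] := zsys. Qed.
Let z'_end k : z' k (ell k) = (g 0 k)^*. Proof. by have [_ _ ->] := zsys. Qed.
(** The outer solution of a whole edge, restricted to an end piece, is the outer solution of that
    piece; hence its Evans function is - z_k(s) and its Neumann data z_k'(s) / z_k(s). *)
Let z_sol k s : 0 < s -> edge_solution s (ell k) (V k) lam (z k) (z' k).
Proof.
by move=> s0; have [zs _ _] := zsys; exact: edge_solution_subset (ltW s0) _ (zs k).
Qed.
Let L1_end k s : 0 < s -> L1_on s (ell k) (V k).
Proof. by move=> s0; exact: L1_on_subset (ltW s0) _ (hV k). Qed.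

Let end_graph k s : star_graph R 1 := interval_graph s (ell k) (V k).
Let end_cond k : bound_cond R 1 := interval_cond 1 0 (g 0 k) (h 0 k).

Let evans_end k s : 0 < s < ell k -> evans (end_graph k s) (end_cond k) lam = - z k s.
Proof.
move=> /andP[s0 sl]; have [_ _ _ _ gh] := regG; have [gh1 gh2] := gh k.
exact: (evans_interval sl (L1_end k s0) gh1 gh2 (z_sol k s0) (z_end k) (z'_end k)).
Qed.

Let end_neq0 k s : 0 < s < ell k ->
  resolvent_set (end_graph k s) (end_cond k) lam -> z k s != 0.
Proof.
move=> /andP[s0 sl]; have [_ _ _ _ gh] := regG; have [gh1 gh2] := gh k.
exact: (interval_left_neq0 sl (L1_end k s0) gh1 gh2 (z_sol k s0) (z_end k) (z'_end k)).
Qed.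

Let end_dtn_exists k s c : 0 < s < ell k ->
  resolvent_set (end_graph k s) (end_cond k) lam ->
  exists u p : 'I_1 -> R -> R[i], [/\ solution (end_graph k s) lam u p, u 0 s = c,
    outer_cond (end_graph k s) (end_cond k) u p & p 0 s = z' k s / z k s * c].
Proof.
move=> /andP[s0 sl]; have [_ _ _ _ gh] := regG; have [gh1 gh2] := gh k.
move=> res; exact: (interval_dtn_exists sl (L1_end k s0) gh1 gh2 (z_sol k s0)
  (z_end k) (z'_end k) res c).
Qed.

Let end_dtn_unique k s (u p : 'I_1 -> R -> R[i]) : 0 < s < ell k ->
  resolvent_set (end_graph k s) (end_cond k) lam ->
  solution (end_graph k s) lam u p -> outer_cond (end_graph k s) (end_cond k) u p ->
  p 0 s = z' k s / z k s * u 0 s.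
Proof.
move=> /andP[s0 sl]; have [_ _ _ _ gh] := regG; have [gh1 gh2] := gh k.
move=> res; exact: (interval_dtn_unique sl (L1_end k s0) gh1 gh2 (z_sol k s0)
  (z_end k) (z'_end k) res).
Qed.

Lemma piece1_problemP j s c d : 0 < s < ell j ->
  resolvent_set (piece1 ell V j s) (cond1 G j) lam ->
  piece1_problem ell V G j s lam c d <-> d = z' j s / z j s * c.
Proof.
rewrite /piece1_problem cond1E => sl res; split=> [[u [p [usol <- uout ->]]]|->].
  exact: end_dtn_unique usol uout.
have [u [p [usol us uout ps]]] := end_dtn_exists c sl res.
by exists u, p.
Qed.

(** Factoring - z_j(s1) and - z_i(s2) out of the rows of the principal minor of D1 - D2 T on edges j
    and i leaves [M1 + M2], and these factors are the Evans functions of the two end pieces.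
    Nonvanishing is part of the claim because division by zero would return 0. *)
Lemma two_sided_det_diff i j s1 s2 : i != j -> 0 < s1 < ell j -> 0 < s2 < ell i ->
  resolvent_set (piece1 ell V j s1) (cond1 G j) lam ->
  resolvent_set (tpiece1 ell V i j s1 s2) (tcond1 G i j) lam ->
  resolvent_set (tpiece2 ell V i j s1 s2) (tcond2 G i j) lam ->
  let E := evans (star ell V) G lam in
  let E1 := evans (piece1 ell V j s1) (cond1 G j) lam in
  let tE1 := evans (tpiece1 ell V i j s1 s2) (tcond1 G i j) lam in
  let tE2 := evans (tpiece2 ell V i j s1 s2) (tcond2 G i j) lam in
  E1 * tE1 * tE2 != 0 /\
  E / (E1 * tE1 * tE2)
    = \det (M1 ell V G i j s1 s2 lam + M2 ell V G i j s1 s2 lam).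
Proof.
move=> ij hs1 hs2 res1 rest1 res2.
have tp1 : tpiece1 ell V i j s1 s2 = end_graph i s2 by rewrite /tpiece1 (negbTE ij).
have tc1 : tcond1 G i j = end_cond i.
  by have [b1 b2 _ _ _] := regG; rewrite /tcond1 (negbTE ij) b1 b2 !diag_entry.
rewrite tp1 tc1 in rest1 *.
have res1' := res1; rewrite cond1E in res1'.
have hout k : 0 < out (tpiece2 ell V i j s1 s2) k <= ell k.
  move: hs1 hs2 => /andP[s10 s1l] /andP[s20 s2l] /=.
  have [->|_] := eqVneq k i; first by rewrite s20 ltW.
  by have [->|_] := eqVneq k j; [rewrite s10 ltW|rewrite hell lexx].
have [Y [Y' Ysys]] := origin_system_exists G lam (regular_star hell hV).
have [y [y' ysys]] := outer_system_exists (\row_k if shortened i j k then 1 else g 0 k)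
  (\row_k if shortened i j k then 0 else h 0 k) lam (regular_shortened hV hout).
have outi : out (tpiece2 ell V i j s1 s2) i = s2 by rewrite /= eqxx.
have outj : out (tpiece2 ell V i j s1 s2) j = s1.
  by rewrite /= eq_sym (negbTE ij) eqxx.
have shi : shortened i j i by rewrite /shortened eqxx.
have shj : shortened i j j by rewrite /shortened eqxx orbT.
pose T := dtn_mx ell V i j s1 s2 Y Y' y y'.
have tE2_neq0 : evans (tpiece2 ell V i j s1 s2) (tcond2 G i j) lam != 0.
  rewrite (evans_shortened hV regG hout Ysys ysys).
  by have := shortened_mx_unit hV regG hout Ysys ysys res2; rewrite unitmxE unitfE.
have z1 := end_neq0 hs1 res1'; have z2 := end_neq0 hs2 rest1.
have M1E : M1 ell V G i j s1 s2 lam = mx2 (- (z' j s1 / z j s1)) 0 0 (- (z' i s2 / z i s2)).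
  apply: matrix_ofE; rewrite /map1 (negbTE ij) /diff_wire_map1 tp1 tc1.
    move=> f; exists (z' j s1 / z j s1 * f 0 0); first by apply/piece1_problemP.
    have [w [p [wsol ws wout ps]]] := end_dtn_exists (f 1 0) hs2 rest1.
    by exists w, p; split => //; rewrite mx2_mul ps !mul0r addr0 add0r !mulNr.
  move=> f _ _ [d /(piece1_problemP _ _ hs1 res1) -> [w [p [wsol ws wout ->]]]]
    [d' /(piece1_problemP _ _ hs1 res1) -> [w' [p' [w'sol w's w'out ->]]]].
  rewrite (end_dtn_unique hs2 rest1 wsol wout) ws.
  by rewrite (end_dtn_unique hs2 rest1 w'sol w'out) w's.
have M2E : M2 ell V G i j s1 s2 lam = mx2 (T j j) (T j i) (T i j) (T i i).
  apply: matrix_ofE; rewrite /map2 (negbTE ij) /diff_wire_map2.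
    move=> f; pose F : 'cV[R[i]]_n :=
      \col_k if k == i then f 1 0 else if k == j then f 0 0 else 0.
    have [|w [p [wprob wF pT]]] := shortened_dtn_exists hV regG hout Ysys ysys res2 (f := F).
      by move=> k; rewrite /shortened negb_or mxE => /andP[/negbTE -> /negbTE ->].
    exists w, p; split => //.
    - by have := wF j shj; rewrite outj mxE eq_sym (negbTE ij) eqxx.
    - by have := wF i shi; rewrite outi mxE eqxx.
    - have TF k : (T *m F) k 0 = T k j * f 0 0 + T k i * f 1 0.
        rewrite mxE (bigD1 j)//= (bigD1 i)//= big1 ?addr0 => [|l /andP[lj li]].
          by rewrite ![F _ _]mxE !eqxx [j == i]eq_sym (negbTE ij).
        by rewrite [F _ _]mxE (negbTE lj) (negbTE li) mulr0.
      have := pT i; have := pT j; rewrite outi outj => -> ->.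
      by rewrite mx2_mul -/T !TF.
  move=> f _ _ [w [p [wprob wj wi ->]]] [w' [p' [w'prob w'j w'i ->]]].
  have ww' k : shortened i j k ->
      w k (out (tpiece2 ell V i j s1 s2) k) = w' k (out (tpiece2 ell V i j s1 s2) k).
    by move=> /orP[] /eqP ->; rewrite ?outi ?outj ?wi ?wj.
  have := shortened_dtn_unique hV regG hout res2 wprob w'prob ww' => pp'.
  by have := pp' i; have := pp' j; rewrite outi outj => -> ->.
(* Edge j comes first, in accordance with the order (s1, s2) of the two-sided map. *)
pose f (k : 'I_2) := if k == 0 then j else i.
have finj : injective f.
  move=> k l; rewrite /f; case: k => [[|[|//]] hk]; case: l => [[|[|//]] hl] //=.
  - by move=> _; exact: val_inj.
  - by move=> /eqP; rewrite eq_sym (negbTE ij).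
  - by move=> /eqP; rewrite (negbTE ij).
  - by move=> _; exact: val_inj.
have fs k : k \notin codom f -> ~~ shortened i j k.
  apply: contra => /orP[] /eqP ->; apply/codomP; [by exists 1|by exists 0].
have XE : mxsub f f (splitting_mx ell V i j s1 s2 Y Y' y y' z z') =
    mx2 (z' j s1 - z j s1 * T j j) (- (z j s1 * T j i))
        (- (z i s2 * T i j)) (z' i s2 - z i s2 * T i i).
  apply/matrixP => k l; rewrite /splitting_mx mul_diag_mx !mxE /f.
  case: k => [[|[|//]] hk]; case: l => [[|[|//]] hl];
  by rewrite /= ?outi ?outj ?shi ?shj ?eqxx ?(negbTE ij) 1?[j == i]eq_sym
    ?(negbTE ij) ?mulr1n ?mulr0n ?add0r.
move=> E E1 tE1 tE2.
have EE : E = ((z' j s1 - z j s1 * T j j) * (z' i s2 - z i s2 * T i i) -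
    (- (z j s1 * T j i)) * (- (z i s2 * T i j))) * tE2.
  rewrite /E (evans_split hell hV regG hout Ysys ysys res2 zsys).
  by rewrite (det_splitting_mx ell V s1 s2 Y Y' y y' z z' finj fs) XE det_mx2.
have E1E : E1 = - z j s1 by rewrite /E1 cond1E; exact: evans_end hs1.
have tE1E : tE1 = - z i s2 by exact: evans_end hs2.
rewrite M1E M2E mx2D det_mx2 EE E1E tE1E; split.
  by rewrite !mulf_neq0// oppr_eq0.
by field; rewrite tE2_neq0 z1 z2.
Qed.

(** Only edge j is shortened, so the minor is the single entry z_j'(s2) - z_j(s2) T_jj. The middle
    interval carries the data of z_j from s2 to s1 and thereby brings in the 2 x 2 determinant. *)
Lemma two_sided_det_same j s1 s2 : 0 < s1 < ell j -> 0 < s2 < s1 ->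
  resolvent_set (piece1 ell V j s1) (cond1 G j) lam ->
  resolvent_set (tpiece1 ell V j j s1 s2) (tcond1 G j j) lam ->
  resolvent_set (tpiece2 ell V j j s1 s2) (tcond2 G j j) lam ->
  let E := evans (star ell V) G lam in
  let E1 := evans (piece1 ell V j s1) (cond1 G j) lam in
  let tE1 := evans (tpiece1 ell V j j s1 s2) (tcond1 G j j) lam in
  let tE2 := evans (tpiece2 ell V j j s1 s2) (tcond2 G j j) lam in
  E1 * tE1 * tE2 != 0 /\
  E / (E1 * tE1 * tE2)
    = \det (M1 ell V G j j s1 s2 lam + M2 ell V G j j s1 s2 lam).
Proof.
move=> hs1 /andP[s20 s21] res1 rest1 res2.
have tp1 : tpiece1 ell V j j s1 s2 = interval_graph s2 s1 (V j) by rewrite /tpiece1 eqxx.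
have tc1 : tcond1 G j j = interval_cond 1 0 1 0 by rewrite /tcond1 eqxx.
rewrite tp1 tc1 in rest1 *.
have /andP[s10 s1l] := hs1; have s1l' := ltW s1l.
have res1' := res1; rewrite cond1E in res1'.
have hout k : 0 < out (tpiece2 ell V j j s1 s2) k <= ell k.
  move=> /=; have [->|_] := eqVneq k j; last by rewrite hell lexx.
  by rewrite s20 ltW// (lt_trans s21).
have [Y [Y' Ysys]] := origin_system_exists G lam (regular_star hell hV).
have [y [y' ysys]] := outer_system_exists (\row_k if shortened j j k then 1 else g 0 k)
  (\row_k if shortened j j k then 0 else h 0 k) lam (regular_shortened hV hout).
have outj : out (tpiece2 ell V j j s1 s2) j = s2 by rewrite /= eqxx.
have shj : shortened j j j by rewrite /shortened eqxx.
pose T := dtn_mx ell V j j s1 s2 Y Y' y y'.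
have tE2_neq0 : evans (tpiece2 ell V j j s1 s2) (tcond2 G j j) lam != 0.
  rewrite (evans_shortened hV regG hout Ysys ysys).
  by have := shortened_mx_unit hV regG hout Ysys ysys res2; rewrite unitmxE unitfE.
have z1 := end_neq0 hs1 res1'.
have L12 : L1_on s2 s1 (V j) by exact: L1_on_subset (ltW s20) s1l' (hV j).
have s1in : s2 <= s1 <= s1 by rewrite lexx ltW.
have s2in : s2 <= s2 <= s1 by rewrite lexx ltW.
(* [et] and [th] vanish with slope 1 at s1 and s2 respectively; [et] is also the outer solution of
   the middle interval. *)
have [et [et' [etsol et1 et'1]]] := edge_solution_exists lam 0 1 s1in L12.
have [th [th' [thsol th2 th'2]]] := edge_solution_exists lam 0 1 s2in L12.
have one_sa : (1 : R[i]) * 0^* = 0 * 1^* by rewrite conjC0 mulr0 mul0r.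
have one0 : ((1 : R[i]) != 0) || ((0 : R[i]) != 0) by rewrite oner_eq0.
have et1' : et s1 = - 0^* by rewrite conjC0 oppr0.
have et'1' : et' s1 = 1^* by rewrite conjC1.
have et2 : et s2 != 0.
  exact: (interval_left_neq0 s21 L12 one_sa one0 etsol et1' et'1' rest1).
(* [D] is the Evans function of the middle interval, and by the Wronskian also the value of [th] at
   s1. *)
pose D := - et s2.
have D0 : D != 0 by rewrite oppr_eq0.
have th1 : th s1 = D.
  have := wronskian_cst thsol etsol s1in s2in.
  by rewrite et1 et'1 th2 th'2 mulr1 mulr0 subr0 mul0r sub0r mul1r.
have et2E : et s2 = - D by rewrite opprK.
have zs : edge_solution s2 s1 (V j) lam (z j) (z' j).
  by have [zs _ _] := zsys; exact: edge_solution_subset (ltW s20) s1l' (zs j).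
(* The Wronskians of z_j with [th] and [et] express its data at s2 through those at s1. *)
have z2E : z j s2 = z j s1 * th' s1 - z' j s1 * D.
  have := wronskian_cst zs thsol s2in s1in.
  by rewrite th2 th'2 th1 mulr1 mulr0 subr0.
have z2'E : z' j s2 * D = z j s1 - z j s2 * et' s2.
  have := wronskian_cst zs etsol s1in s2in.
  by rewrite et1 et'1 et2E mulr1 mulr0 subr0 => ->; ring.
have M1E : M1 ell V G j j s1 s2 lam =
    mx2 (th' s1 / D) (- D^-1) (- D^-1) (et' s2 / D).
  apply: matrix_ofE; rewrite /map1 eqxx /same_wire_map1 tp1.
    (* Since [th] is 0 at s2 and [D] at s1, while [et] is 0 at s1 and [- D] at s2, each coefficient
       meets one boundary value. *)
    move=> f; pose c := f 0 0 / D; pose d := - (f 1 0 / D).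
    exists (fun _ x => c * th x + d * et x), (fun _ x => c * th' x + d * et' x); split.
    - by move=> k; exact: edge_solution_lin.
    - by rewrite th1 et1 mulr0 addr0 divfK.
    - by rewrite th2 et2E mulr0 add0r /d mulrNN divfK.
    - rewrite mx2_mul et'1 th'2 /c /d; congr pair_col; ring.
  move=> f _ _ [w [p [wsol w1 w2 ->]]] [w' [p' [w'sol w'1 w'2 ->]]].
  have dsol : solution (interval_graph s2 s1 (V j)) lam
      (fun k x => 1 * w k x + (-1) * w' k x) (fun k x => 1 * p k x + (-1) * p' k x).
    by move=> k; exact: edge_solution_lin.
  have [B1 B2 _ _ _] := regular_interval_cond one_sa one0.
  have dout : outer_cond (interval_graph s2 s1 (V j)) (interval_cond 1 0 1 0)
      (fun k x => 1 * w k x + (-1) * w' k x) (fun k x => 1 * p k x + (-1) * p' k x).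
    apply/(outer_cond_diag _ _ _ B1 B2) => k; rewrite !mxE ord1 /= w1 w'1; ring.
  have dorg : origin_cond (interval_graph s2 s1 (V j)) (interval_cond 1 0 1 0)
      (fun k x => 1 * w k x + (-1) * w' k x) (fun k x => 1 * p k x + (-1) * p' k x).
    rewrite /origin_cond /= mul1mx !mul_scalar_mx scale0r addr0.
    by apply/matrixP => k l; rewrite !mxE !ord1 w2 w'2; ring.
  have pp x : s2 <= x <= s1 -> p 0 x = p' 0 x.
    move=> xs; have := bvp_trivial (regular_interval s21 L12) rest1 dsol dorg dout (k := 0) xs.
    by move=> -[_ /eqP]; rewrite mul1r mulN1r subr_eq0 => /eqP.
  by rewrite !pp.
have M2E : M2 ell V G j j s1 s2 lam = mx2 (- (z' j s1 / z j s1)) 0 0 (T j j).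
  apply: matrix_ofE; rewrite /map2 eqxx /same_wire_map2.
    move=> f; exists (z' j s1 / z j s1 * f 0 0); first by apply/piece1_problemP.
    pose F : 'cV[R[i]]_n := \col_k if k == j then f 1 0 else 0.
    have [|w [p [wprob wF pT]]] := shortened_dtn_exists hV regG hout Ysys ysys res2 (f := F).
      by move=> k; rewrite /shortened orbb mxE => /negbTE ->.
    exists w, p; split => //; first by have := wF j shj; rewrite outj mxE eqxx.
    have TF : (T *m F) j 0 = T j j * f 1 0.
      rewrite mxE (bigD1 j)//= big1 ?addr0 => [|l lj].
        by rewrite [F _ _]mxE eqxx.
      by rewrite [F _ _]mxE (negbTE lj) mulr0.
    have := pT j; rewrite outj -/T TF => ->.
    by rewrite mx2_mul !mul0r addr0 add0r mulNr.
  move=> f _ _ [d /(piece1_problemP _ _ hs1 res1) -> [w [p [wprob wj ->]]]]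
    [d' /(piece1_problemP _ _ hs1 res1) -> [w' [p' [w'prob w'j ->]]]].
  have ww' k : shortened j j k ->
      w k (out (tpiece2 ell V j j s1 s2) k) = w' k (out (tpiece2 ell V j j s1 s2) k).
    by rewrite /shortened orbb => /eqP ->; rewrite outj wj.
  have := shortened_dtn_unique hV regG hout res2 wprob w'prob ww' j.
  by rewrite outj => ->.
pose f (_ : 'I_1) := j.
have finj : injective f by move=> k l _; rewrite !ord1.
have fs k : k \notin codom f -> ~~ shortened j j k.
  by apply: contra; rewrite /shortened orbb => /eqP ->; apply/codomP; exists 0.
move=> E E1 tE1 tE2.
have EE : E = (z' j s2 - z j s2 * T j j) * tE2.
  rewrite /E (evans_split hell hV regG hout Ysys ysys res2 zsys).
  rewrite (det_splitting_mx ell V s1 s2 Y Y' y y' z z' finj fs) det_mx11.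
  by rewrite /splitting_mx mul_diag_mx !mxE /f shj outj eqxx mulr1n.
have E1E : E1 = - z j s1 by rewrite /E1 cond1E; exact: evans_end hs1.
have tE1E : tE1 = D by exact: (evans_interval s21 L12 one_sa one0 etsol et1' et'1').
rewrite M1E M2E mx2D det_mx2 EE E1E tE1E; split.
  by rewrite !mulf_neq0// oppr_eq0.
(* Eliminating the data of z_j at s2 leaves a rational identity in its data at s1, T_jj, [D] and the
   slopes of [th] and [et]. *)
have -> : z' j s2 = (z j s1 - z j s2 * et' s2) / D by rewrite -z2'E mulfK.
by rewrite z2E; field; rewrite tE2_neq0 z1 D0.
Qed.

End Splitting.

Unset Implicit Arguments.

Theorem theorem1p10 (R : realType) (n : nat) (hn : (1 <= n)%N)
  (ell : 'I_n -> R) (hell : forall k, 0 < ell k)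
  (V : 'I_n -> R -> R[i]) (hV : forall k, L1_on 0 (ell k) (V k))
  (G : bound_cond R n) (hG : selfadjoint_cond G)
  (g h : 'rV[R[i]]_n) (hb1 : beta1 G = diag_mx g) (hb2 : beta2 G = diag_mx h)
  (i j : 'I_n) (s1 s2 : R) (hs1 : 0 < s1 < ell j)
  (hs2 : 0 < s2 < (if i == j then s1 else ell i))
  (lam : R[i])
  (hlam : (resolvent_set (piece1 ell V j s1) (cond1 G j)
           `&` resolvent_set (tpiece1 ell V i j s1 s2) (tcond1 G i j)
           `&` resolvent_set (tpiece2 ell V i j s1 s2) (tcond2 G i j)) lam) :
  let E := evans (star ell V) G lam in
  let E1 := evans (piece1 ell V j s1) (cond1 G j) lam in
  let tE1 := evans (tpiece1 ell V i j s1 s2) (tcond1 G i j) lam in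
  let tE2 := evans (tpiece2 ell V i j s1 s2) (tcond2 G i j) lam in
  E1 * tE1 * tE2 != 0 /\
  E / (E1 * tE1 * tE2)
    = \det (M1 ell V G i j s1 s2 lam + M2 ell V G i j s1 s2 lam).
Proof.
have regG := selfadjoint_regular hG hb1 hb2.
have [z [z' zsys]] := outer_system_exists g h lam (regular_star hell hV).
case: hlam => -[res1 rest1] res2.
have [ij|ij] := eqVneq i j.
  move: rest1 res2 hs2; rewrite ij eqxx => rest1 res2 hs2.
  exact: (two_sided_det_same hell hV regG zsys hs1 hs2 res1 rest1 res2).
rewrite (negbTE ij) in hs2.
exact: (two_sided_det_diff hell hV regG zsys ij hs1 hs2 res1 rest1 res2).
Qed.
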